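(* Let $(a,b)\subset\mathbb{R}$ be a finite interval, $m,n\in\mathbb{N}$, $\varepsilon_0>0$. For each $\varepsilon\in[0,\varepsilon_0)$ let $A(\cdot;\varepsilon)\in (W^{n-1}_\infty)^{m\times m}$, let $B(\varepsilon)\colon (W^n_\infty)^m\to\mathbb{C}^m$ be a bounded linear operator, and set $L(\varepsilon)y:=y'+A(\cdot;\varepsilon)y$. Assume: (0) the problem $L(0)y=0$ on $(a,b)$, $B(0)y=0$ has only the trivial solution in $(W^n_\infty)^m$; (I) $A(\cdot;\varepsilon)\to A(\cdot;0)$ in $(W^{n-1}_\infty)^{m\times m}$ as $\varepsilon\to0+$; (II) $B(\varepsilon)y\to B(0)y$ in $\mathbb{C}^m$ as $\varepsilon\to0+$ for every $y\in(W^n_\infty)^m$. Then there exist positive numbers $\varepsilon_2$, $\gamma_1$, $\gamma_2$ such that for every $\varepsilon\in(0,\varepsilon_2)$ and all right-hand sides $f(\cdot;0),f(\cdot;\varepsilon)\in(W^{n-1}_\infty)^m$, $c(0),c(\varepsilon)\in\mathbb{C}^m$, the unique solutions $y(\cdot;\varepsilon)$ of $L(\varepsilon)y=f(\cdot;\varepsilon)$, $B(\varepsilon)y=c(\varepsilon)$ and $y(\cdot;0)$ of $L(0)y=f(\cdot;0)$, $B(0)y=c(0)$ satisfy $$\gamma_1\,\widetilde d_{n-1,\infty}(\varepsilon)\le \|y(\cdot;0)-y(\cdot;\varepsilon)\|_{n,\infty}\le \gamma_2\,\widetilde d_{n-1,\infty}(\varepsilon),$$ where $\widetilde d_{n-1,\infty}(\varepsilon):=\|L(\varepsilon)y(\cdot;0)-f(\cdot;\varepsilon)\|_{n-1,\infty}+\|B(\varepsilon)y(\cdot;0)-c(\varepsilon)\|_{\mathbb{C}^m}$;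 the numbers $\varepsilon_2,\gamma_1,\gamma_2$ do not depend on $y(\cdot;0)$ and $y(\cdot;\varepsilon)$.
   Context: For an integer $k\ge0$, $W^k_\infty=W^k_\infty([a,b];\mathbb{C})$ is the Sobolev space of complex functions on $[a,b]$ whose derivatives up to order $k$ are essentially bounded, with norm $\|y\|_{k,\infty}=\sum_{j=0}^k\|y^{(j)}\|_{L_\infty}$; $W^0_\infty=L_\infty$. $(W^k_\infty)^m$ and $(W^k_\infty)^{m\times m}$ denote vector/matrix functions with components in $W^k_\infty$, normed componentwise. A solution of $L(\varepsilon)y=f$, $B(\varepsilon)y=c$ is a $y\in(W^n_\infty)^m$ satisfying $y'+A(\cdot;\varepsilon)y=f$ almost everywhere on $(a,b)$ and $B(\varepsilon)y=c$. $\|\cdot\|_{\mathbb{C}^m}$ is a norm on $\mathbb{C}^m$. *)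

(* Defs.v *)
From HB Require Import structures.
From mathcomp Require Import all_boot all_order all_algebra.
From mathcomp Require Import all_classical all_reals all_analysis.
From mathcomp Require Import complex.
Set Implicit Arguments.
Unset Strict Implicit.
Unset Printing Implicit Defensive.
Import Order.TTheory GRing.Theory Num.Theory.
Import numFieldNormedType.Exports.
Local Open Scope classical_set_scope.
Local Open Scope ring_scope.

Section Sobolev.
Variable R : realType.

Definition C := R[i].

Definition cabs (z : C) : R := Num.sqrt (complex.Re z ^+ 2 + complex.Im z ^+ 2).

Definition leb := @lebesgue_measure R.

Definition cint (D : set R) (g : R -> C) : C :=
  Complex (\int[leb]_(t in D) complex.Re (g t)) (\int[leb]_(t in D) complex.Im (g t)).

Definition ess_bdd (a b : R) (g : R -> C) : Prop :=
  measurable_fun `[a, b] (fun t => complex.Re (g t)) /\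
  measurable_fun `[a, b] (fun t => complex.Im (g t)) /\
  exists M : R, {ae leb, forall t, [set` `[a, b]] t -> cabs (g t) <= M}.

Definition linf (a b : R) (g : R -> C) : R :=
  inf [set M : R | 0 <= M /\ {ae leb, forall t, [set` `[a, b]] t -> cabs (g t) <= M}].

(* d is a chain of (weak) derivatives d 0 = g, d 1 = g', ..., d k = g^(k)
   witnessing g \in W^k_infty(a,b): d 0 = g a.e. on [a,b], each d j
   (j <= k) is essentially bounded, and for j < k, d j is the indefinite
   integral of d (j+1) (i.e. absolutely continuous with derivative d (j+1)). *)
Definition deriv_chain (a b : R) (k : nat) (g : R -> C) (d : nat -> R -> C) :=
  {ae leb, forall t, [set` `[a, b]] t -> d 0%N t = g t} /\
  (forall j, (j <= k)%N -> ess_bdd a b (d j)) /\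
  (forall j, (j < k)%N -> forall x, [set` `[a, b]] x ->
      d j x = d j a + cint `[a, x] (d j.+1)).

Definition inW (a b : R) (k : nat) (g : R -> C) : Prop :=
  exists d, deriv_chain a b k g d.

Definition dchain (a b : R) (k : nat) (g : R -> C) : nat -> R -> C :=
  match pselect (inW a b k g) with
  | left P => projT1 (cid P)
  | right _ => fun _ _ => 0
  end.

Definition sobnorm (a b : R) (k : nat) (g : R -> C) : R :=
  \sum_(j < k.+1) linf a b (dchain a b k g j).

Definition inWv (a b : R) (k m : nat) (y : R -> 'cV[C]_m) : Prop :=
  forall i, inW a b k (fun t => y t i 0).

Definition inWm (a b : R) (k m : nat) (A : R -> 'M[C]_m) : Prop :=
  forall i j, inW a b k (fun t => A t i j).

Definition sobnormv (a b : R) (k m : nat) (y : R -> 'cV[C]_m) : R :=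
  \sum_(i < m) sobnorm a b k (fun t => y t i 0).

Definition sobnormm (a b : R) (k m : nat) (A : R -> 'M[C]_m) : R :=
  \sum_(i < m) \sum_(j < m) sobnorm a b k (fun t => A t i j).

Definition vderiv (a b : R) (m : nat) (y : R -> 'cV[C]_m) : R -> 'cV[C]_m :=
  fun t => \col_i dchain a b 1 (fun s => y s i 0) 1%N t.

Definition Lop (a b : R) (m : nat) (A : R -> 'M[C]_m) (y : R -> 'cV[C]_m)
  : R -> 'cV[C]_m := fun t => vderiv a b y t + A t *m y t.

Definition is_solution (a b : R) (n m : nat) (A : R -> 'M[C]_m)
  (B : (R -> 'cV[C]_m) -> 'cV[C]_m) (f : R -> 'cV[C]_m) (c : 'cV[C]_m)
  (y : R -> 'cV[C]_m) : Prop :=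
  inWv a b n y /\ {ae leb, forall t, [set` `]a, b[] t -> Lop a b A y t = f t} /\
  B y = c.

Definition is_norm (m : nat) (nrm : 'cV[C]_m -> R) : Prop :=
  (forall v, 0 <= nrm v) /\ (forall v, nrm v = 0 -> v = 0) /\
  (forall v w, nrm (v + w) <= nrm v + nrm w) /\
  (forall (l : C) v, nrm (l *: v) = cabs l * nrm v).

Definition bounded_linear_op (a b : R) (n m : nat) (nrm : 'cV[C]_m -> R)
  (B : (R -> 'cV[C]_m) -> 'cV[C]_m) : Prop :=
  (forall (l : C) y z, inWv a b n y -> inWv a b n z ->
      B (fun t => l *: y t + z t) = l *: B y + B z) /\
  exists K : R, forall y, inWv a b n y -> nrm (B y) <= K * sobnormv a b n y.

End Sobolev.

(* Main.v *)
(* Every y in W^n is determined by L(0) y and y(a), and Gronwall's inequality with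
   a bootstrap over the derivatives gives
     |y|_n <= K (|L(0) y|_(n-1) + |y(a)|).
   Let U be a fundamental matrix of L(0). Hypothesis (0) says that the matrix
   B(0) U is injective, and by (II) the matrices B(e) U tend to it, so
   |q| <= C |B(e) U q| for small e. Splitting y = v + U q with v(a) = 0 gives
   B(e) U q = B(e) y - B(e) v, where |v|_n <= K |L(0) y|_(n-1) and the B(e) are
   uniformly bounded by the Banach-Steinhaus theorem. Hence
     |y|_n <= K' (|L(0) y|_(n-1) + |B(e) y|)
   uniformly in e, and by (I) L(0) may be replaced by L(e). Applied to
   y = y(.;0) - y(.;e), this inequality and the uniform boundedness of L(e) and
   B(e) are the two estimates; it also makes the boundary matrix of the
   e-problem injective, whence unique solvability. *)
Require Import Defs.
From HB Require Import structures.
From mathcomp Require Import all_boot all_order all_algebra.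
From mathcomp Require Import all_classical all_reals all_analysis.
From mathcomp Require Import complex.
From mathcomp Require Import measurable_realfun ring lra.
Set Implicit Arguments.
Unset Strict Implicit.
Unset Printing Implicit Defensive.
Import Order.TTheory GRing.Theory Num.Theory.
Import numFieldNormedType.Exports.
Local Open Scope classical_set_scope.
Local Open Scope ring_scope.

(** * Almost-everywhere statements and primitives *)

Section AlmostEverywhere.
Variables (R : realType) (a b : R).
Notation mu := (@lebesgue_measure R).

(** The obstacle is the choice of representatives: derivatives come from the choice [dchain], known
    only up to null sets, and an essentially bounded function need not be bounded. So functions are
    exchanged for measurable ones bounded everywhere ([bmc]), derivatives are described by the
    relation [prs], and their uniqueness ([cprim_ae_inj]) turns the Sobolev norm into the recursion
    |y|_(k+1) = |y|_oo + |y'|_k, on which the estimates in W^k are inductions. Completeness of W^n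
    enters through series dominated by a geometric one, the kind that a gliding hump produces.
    Banach-Steinhaus concerns a sequence, whereas (II) bounds B(e) y only for e below a threshold
    that depends on y; hence an argument by contradiction along some e_n < eps0 / (n + 1). Passing
    from L(0) to L(e) costs a multiple of |A(e) - A(0)| |y|_n, absorbed on the left once it is at
    most |y|_n / 2. Finally gamma_2 is the stability constant, and gamma_1 = 1 / (L0 + M), where L0
    bounds the L(e) and M the B(e). *)

Definition aeI (P : R -> Prop) := {ae mu, forall t, [set` `[a, b]] t -> P t}.

Lemma aeI_all (P : R -> Prop) : (forall t, a <= t <= b -> P t) -> aeI P.
Proof.
by move=> h; apply: (@aeW _ (measurableTypeR R)) => t; rewrite /= in_itv; exact: h.
Qed.

Lemma aeI_and (P Q : R -> Prop) : aeI P -> aeI Q -> aeI (fun t => P t /\ Q t).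
Proof.
move=> hP hQ.
have := @filterI _ _ (ae_filter_ringOfSetsType mu) _ _ hP hQ.
apply: (@filterS _ _ (ae_filter_ringOfSetsType mu)).
by move=> t [h1 h2] tI; split; [exact: h1|exact: h2].
Qed.

Lemma aeI_sub (P Q : R -> Prop) :
  (forall t, a <= t <= b -> P t -> Q t) -> aeI P -> aeI Q.
Proof.
move=> h; apply: (@filterS _ _ (ae_filter_ringOfSetsType mu)).
by move=> t hP tI; apply: h; [move: tI; rewrite /= in_itv|exact: hP].
Qed.

Lemma aeI_sub2 (P Q S : R -> Prop) :
  (forall t, a <= t <= b -> P t -> Q t -> S t) -> aeI P -> aeI Q -> aeI S.
Proof.
move=> h hP hQ; apply: aeI_sub (aeI_and hP hQ) => t tI [p q].
exact: h.
Qed.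

Lemma aeI_sub3 (P Q S U : R -> Prop) :
  (forall t, a <= t <= b -> P t -> Q t -> S t -> U t) ->
  aeI P -> aeI Q -> aeI S -> aeI U.
Proof.
move=> h hP hQ; apply: aeI_sub2 (aeI_and hP hQ) => t tI [p q].
exact: h.
Qed.

Lemma aeI_nat (P : nat -> R -> Prop) :
  (forall k, aeI (P k)) -> aeI (fun t => forall k, P k t).
Proof.
move=> h; have := ae_foralln h.
by apply: (@filterS _ _ (ae_filter_ringOfSetsType mu)) => t H tI k; exact: H.
Qed.

Lemma aeI_ord (m : nat) (P : 'I_m -> R -> Prop) :
  (forall k, aeI (P k)) -> aeI (fun t => forall k, P k t).
Proof.
move=> h.
have := @aeI_nat (fun k t => forall i : 'I_m, i = k :> nat -> P i t) _.
move=> H; apply: aeI_sub (H _) => [t _ Ht k|k]; first exact: (Ht k).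
have [km|mk] := ltnP k m.
  apply: aeI_sub (h (Ordinal km)) => t _ Pt i ik.
  by have -> : i = Ordinal km by exact: val_inj.
by apply: aeI_all => t _ i ik; have := ltn_ord i; rewrite ik ltnNge mk.
Qed.

Lemma ae_neq (c : R) : {ae mu, forall t, t <> c}.
Proof.
exists [set c]; split; first exact: measurable_set1.
- exact: lebesgue_measure_set1.
- by move=> t /= /contrapT ->.
Qed.

(** The end points form a null set. [is_solution] states the equation on the open interval, while
    norms and derivatives live on the closed one. *)
Lemma aeI_oo (P : R -> Prop) :
  {ae mu, forall t, [set` `]a, b[] t -> P t} <-> aeI P.
Proof.
split => h; last first.
  move: h; apply: (@filterS _ _ (ae_filter_ringOfSetsType mu)) => t h tI.
  apply: h; move: tI; rewrite /= !in_itv /= => /andP[? ?].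
  by apply/andP; split; exact: ltW.
have F := ae_filter_ringOfSetsType mu.
have h1 := @filterI _ _ F _ _ (@filterI _ _ F _ _ (ae_neq a) (ae_neq b)) h.
move: h1; apply: (@filterS _ _ F) => t [[ta tb]] h2.
rewrite /= in_itv /= => /andP[at_ tb_]; apply: h2.
by rewrite /= in_itv /= !lt_neqAle at_ tb_ !andbT; apply/andP; split; apply/eqP => // /esym.
Qed.

(** A null set cannot contain an interval of measure d - c > 0. This supplies actual points at which
    almost-everywhere relations may be evaluated. *)
Lemma aeI_exists (P : R -> Prop) c d : a <= c -> c < d -> d <= b -> aeI P ->
  exists t, c < t < d /\ P t.
Proof.
move=> ac cd db [N [mN N0 sN]]; apply: contrapT => /forallNP nP.
have sub : [set` `]c, d[] `<=` N.
  move=> t tI; apply: sN => /= h.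
  have cdt : c < t < d by move: tI; rewrite /= in_itv.
  apply: (nP t); split => //; apply: h; rewrite in_itv /=.
  by case/andP: cdt => h1 h2; rewrite (le_trans ac (ltW h1)) (le_trans (ltW h2) db).
have : (mu [set` `]c, d[] <= mu N)%E by apply: le_measure; rewrite ?inE.
rewrite N0 lebesgue_measure_itv /= lte_fin cd -EFinB lee_fin subr_le0.
by rewrite leNgt cd.
Qed.

End AlmostEverywhere.

(** * Primitives of bounded measurable real functions *)

Section RealIntegral.
Variables (R : realType) (a b : R).
Hypothesis ab : a < b.
Notation mu := (@lebesgue_measure R).
Notation I := [set` `[a, b]].

(** The bound holds at every point, so that products stay bounded and primitives are Lipschitz
    without exceptional sets. *)
Definition bmr (g : R -> R) :=
  measurable_fun I g /\ exists M, forall t, a <= t <= b -> `|g t| <= M.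

Definition prim (g : R -> R) (x : R) := \int[mu]_(t in `[a, x]) g t.

Lemma bmr_cst c : bmr (fun _ => c).
Proof. by split; [exact: measurable_cst|exists `|c|]. Qed.

Lemma bmrD f g : bmr f -> bmr g -> bmr (fun t => f t + g t).
Proof.
move=> [mf [M fM]] [mg [N gN]]; split; first exact: measurable_funD.
exists (M + N) => t tI; apply: le_trans (ler_normD _ _) _.
by apply: lerD; [exact: fM|exact: gN].
Qed.

Lemma bmrM f g : bmr f -> bmr g -> bmr (fun t => f t * g t).
Proof.
move=> [mf [M fM]] [mg [N gN]]; split; first exact: measurable_funM.
exists (M * N) => t tI; rewrite normrM.
by apply: ler_pM => //; [exact: fM|exact: gN].
Qed.

Lemma bmrZ c g : bmr g -> bmr (fun t => c * g t).
Proof. exact/bmrM/bmr_cst. Qed.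

Lemma bmrN g : bmr g -> bmr (fun t => - g t).
Proof.
move=> /(bmrZ (- 1)); congr bmr; by apply/funext => t; rewrite mulN1r.
Qed.

Lemma bmrB f g : bmr f -> bmr g -> bmr (fun t => f t - g t).
Proof. by move=> hf /bmrN; exact: bmrD. Qed.

Lemma bmr_integrable g (i : interval R) : bmr g -> [set` i] `<=` I ->
  mu.-integrable [set` i] (EFin \o g).
Proof.
move=> [mg [M gM]] s.
apply: (@integrableS _ _ _ mu I) => //.
apply: measurable_bounded_integrable => //=.
  by rewrite lebesgue_measure_itv /= lte_fin ab -EFinB ltry.
exists M; split; first by rewrite num_real.
move=> x Mx t /=; rewrite in_itv => tI.
exact: le_trans (gM _ tI) (ltW Mx).
Qed.

Lemma sub_itvP x y : a <= x -> y <= b -> [set` `[x, y]] `<=` I.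
Proof.
move=> ax yb t; rewrite /= !in_itv /= => /andP[h1 h2].
by rewrite (le_trans ax h1) (le_trans h2 yb).
Qed.

Lemma bmr_int g x : bmr g -> x <= b -> mu.-integrable `[a, x] (EFin \o g).
Proof. by move=> bg xb; apply: bmr_integrable => //; exact: sub_itvP. Qed.

Lemma prim0 g : prim g a = 0.
Proof. by rewrite /prim set_itv1 Rintegral_set1. Qed.

Lemma primD f g x : bmr f -> bmr g -> x <= b ->
  prim (fun t => f t + g t) x = prim f x + prim g x.
Proof. by move=> hf hg xb; rewrite /prim RintegralD //; exact: bmr_int. Qed.

Lemma primZ c g x : bmr g -> x <= b -> prim (fun t => c * g t) x = c * prim g x.
Proof. by move=> hg xb; rewrite /prim RintegralZl //; exact: bmr_int. Qed.

Lemma primB f g x : bmr f -> bmr g -> x <= b ->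
  prim (fun t => f t - g t) x = prim f x - prim g x.
Proof. by move=> hf hg xb; rewrite /prim RintegralB //; exact: bmr_int. Qed.

Lemma prim_ae f g x : measurable_fun I f -> measurable_fun I g -> x <= b ->
  aeI a b (fun t => f t = g t) -> prim f x = prim g x.
Proof.
move=> mf mg xb fg; rewrite /prim /Rintegral; congr fine.
apply: ae_eq_integral => //.
- by apply/measurable_EFinP; apply: measurable_funS mf => //; exact: sub_itvP.
- by apply/measurable_EFinP; apply: measurable_funS mg => //; exact: sub_itvP.
move: fg; apply: (@filterS _ _ (ae_filter_ringOfSetsType mu)) => t h tx.
congr EFin; apply: h; exact: (sub_itvP (lexx a) xb).
Qed.

Lemma prim_le f g x : bmr f -> bmr g -> x <= b ->
  (forall t, a <= t <= x -> f t <= g t) -> prim f x <= prim g x.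
Proof.
move=> hf hg xb fg; apply: le_Rintegral => //; exact: bmr_int.
Qed.

Lemma prim_norm_le f g x : bmr f -> bmr g -> x <= b ->
  (forall t, a <= t <= x -> `|f t| <= g t) -> `|prim f x| <= prim g x.
Proof.
move=> hf hg xb fg; rewrite ler_norml; apply/andP; split.
  rewrite lerNl -mulN1r -primZ //; apply: prim_le => //; first exact: bmrZ.
  by move=> t /fg; rewrite mulN1r ler_norml lerNl => /andP[].
by apply: prim_le => // t /fg; rewrite ler_norml => /andP[].
Qed.

Lemma prim_diff_le g (x y M : R) : bmr g -> a <= x -> x <= y -> y <= b ->
  (forall t, x <= t <= y -> `|g t| <= M) -> `|prim g y - prim g x| <= M * (y - x).
Proof.
move=> hg ax xy yb gM.
rewrite /prim Rintegral_itvB ?bnd_simp //; last exact: bmr_int.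
have sub : [set` `]x, y]] `<=` I.
  move=> t; rewrite /= !in_itv /= => /andP[h1 h2].
  by rewrite (le_trans ax (ltW h1)) (le_trans h2 yb).
apply: le_trans (le_normr_Rintegral _ _) _ => //; first exact: bmr_integrable.
have -> : M * (y - x) = \int[mu]_(t in `]x, y]) M.
  rewrite Rintegral_cst //=; rewrite lebesgue_measure_itv /= lte_fin.
  move: xy; rewrite le_eqVlt => /predU1P[->|xy]; first by rewrite ltxx subrr.
  by rewrite xy.
apply: le_Rintegral => //.
- apply: integrable_norm; exact: bmr_integrable.
- apply: bmr_integrable => //; exact: bmr_cst.
- move=> t; rewrite /= in_itv /= => /andP[h1 h2]; apply: gM.
  by rewrite (ltW h1).
Qed.

Lemma bmr_prim g : bmr g -> bmr (prim g).
Proof.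
move=> hg; split.
  apply: subspace_continuous_measurable_fun => //.
  apply: parameterized_integral_continuous; first exact: ltW.
  exact: bmr_int.
have [_ [M gM]] := hg.
have M0 : 0 <= M by apply: le_trans (normr_ge0 (g a)) (gM a _); rewrite lexx ltW.
exists (M * (b - a)) => t /andP[at_ tb].
have -> : prim g t = prim g t - prim g a by rewrite prim0 subr0.
apply: le_trans (prim_diff_le hg (lexx _) at_ tb _) _.
  by move=> s /andP[as_ st]; apply: gM; rewrite as_ (le_trans st).
by apply: ler_wpM2l => //; apply: lerB.
Qed.

(* Subdividing [a, x] into n parts bounds the increment by K (x - a)^2 / n. *)
Lemma quadratic_cst (H : R -> R) (K : R) :
  (forall x y, a <= x -> x <= y -> y <= b -> `|H y - H x| <= K * (y - x) ^+ 2) ->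
  forall x, a <= x <= b -> H x = H a.
Proof.
move=> HK x /andP[ax xb]; apply/eqP; rewrite -subr_eq0 -normr_le0.
have K0 : 0 <= K.
  have := HK a b (lexx _) (ltW ab) (lexx _); move/(le_trans (normr_ge0 _)).
  by rewrite pmulr_lge0 // exprn_gt0 // subr_gt0.
have step N : `|H x - H a| <= K * (x - a) ^+ 2 / N.+1%:R.
  pose d := (x - a) / N.+1%:R.
  have d0 : 0 <= d by rewrite divr_ge0 // subr_ge0.
  have P k : (k <= N.+1)%N -> `|H (a + k%:R * d) - H a| <= k%:R * (K * d ^+ 2).
    elim: k => [_|k IH kN]; first by rewrite !mul0r addr0 subrr normr0.
    have -> : H (a + k.+1%:R * d) - H a =
      (H (a + k.+1%:R * d) - H (a + k%:R * d)) + (H (a + k%:R * d) - H a) by ring.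
    apply: le_trans (ler_normD _ _) _.
    have -> : k.+1%:R * (K * d ^+ 2) = K * d ^+ 2 + k%:R * (K * d ^+ 2).
      by rewrite -natr1; ring.
    apply: lerD; last by apply: IH; exact: ltnW.
    have e : a + k.+1%:R * d - (a + k%:R * d) = d by rewrite -natr1; ring.
    have := HK (a + k%:R * d) (a + k.+1%:R * d); rewrite e; apply.
    - by rewrite lerDl mulr_ge0.
    - by rewrite -subr_ge0 e.
    - apply: le_trans xb; rewrite -lerBrDl /d mulrA ler_pdivrMr ?ltr0n //.
      by rewrite mulrC ler_wpM2l ?subr_ge0 ?ler_nat.
  have := P N.+1 (leqnn _).
  have -> : a + N.+1%:R * d = x by rewrite /d mulrC divfK ?pnatr_eq0 // addrC subrK.
  move=> h; apply: le_trans h _; rewrite le_eqVlt; apply/orP; left; apply/eqP.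
  by rewrite /d; field; rewrite nat1r pnatr_eq0.
set c := K * (x - a) ^+ 2 in step.
have c0 : 0 <= c by rewrite mulr_ge0 // sqr_ge0.
apply/ler_addgt0Pr => e e0; rewrite add0r.
have [N hN] : exists N : nat, c / e < N.+1%:R.
  exists (Num.truncn (c / e)); exact: truncnS_gt.
apply: le_trans (step N) _.
by rewrite ler_pdivrMr ?ltr0n // mulrC -ler_pdivrMr // ltW.
Qed.

(* The difference of the two sides has quadratic increments, hence is constant:
   this avoids Fubini. *)
Lemma primM c d f g x : bmr f -> bmr g -> a <= x <= b ->
  (c + prim f x) * (d + prim g x) =
  c * d + prim (fun t => f t * (d + prim g t) + (c + prim f t) * g t) x.
Proof.
move=> bf bg xI.
set F := fun t => c + prim f t; set G := fun t => d + prim g t.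
have bF : bmr F by apply: bmrD; [exact: bmr_cst|exact: bmr_prim].
have bG : bmr G by apply: bmrD; [exact: bmr_cst|exact: bmr_prim].
have [_ [M fM]] := bf; have [_ [N gN]] := bg.
have aI : a <= a <= b by rewrite lexx ltW.
have M0 : 0 <= M := le_trans (normr_ge0 _) (fM _ aI).
have N0 : 0 <= N := le_trans (normr_ge0 _) (gN _ aI).
set h := fun t => f t * G t + F t * g t.
have bh : bmr h by apply: bmrD; exact: bmrM.
suff E : F x * G x - prim h x = F a * G a - prim h a.
  have -> : c * d = F a * G a - prim h a by rewrite /F /G !prim0 !addr0 subr0.
  by rewrite -E subrK.
apply: (@quadratic_cst (fun x => F x * G x - prim h x) (M * N + M * N)) => // {xI}x y ax xy yb.
have xb := le_trans xy yb; have ay := le_trans ax xy.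
have FB u v : a <= u -> u <= v -> v <= b -> `|F v - F u| <= M * (v - u).
  move=> au uv vb; rewrite /F opprD addrACA subrr add0r; apply: prim_diff_le => // t /andP[ut tv].
  by apply: fM; rewrite (le_trans au ut) (le_trans tv vb).
have GB u v : a <= u -> u <= v -> v <= b -> `|G v - G u| <= N * (v - u).
  move=> au uv vb; rewrite /G opprD addrACA subrr add0r; apply: prim_diff_le => // t /andP[ut tv].
  by apply: gN; rewrite (le_trans au ut) (le_trans tv vb).
(* Freezing G at y and F at x linearises the increment: F y G y - F x G x = G y (F y - F x) + F x (G
   y - G x). The remaining integrand is of size O(y - x) on [x, y]. *)
set k := fun t => (G y * f t + F x * g t) - h t.
have bk0 : bmr (fun t => G y * f t + F x * g t) by apply: bmrD; exact: bmrZ.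
have bk : bmr k by apply: bmrB.
have E z : z <= b -> prim k z = G y * prim f z + F x * prim g z - prim h z.
  move=> zb; rewrite /k (primB bk0 bh zb) (primD (bmrZ _ bf) (bmrZ _ bg) zb).
  by rewrite (primZ _ bf zb) (primZ _ bg zb).
have -> : F y * G y - prim h y - (F x * G x - prim h x) = prim k y - prim k x.
  by rewrite !E //; rewrite /F /G; ring.
rewrite expr2 mulrA; apply: prim_diff_le => // t /andP[xt ty].
have at_ := le_trans ax xt; have tb := le_trans ty yb.
have tI : a <= t <= b by rewrite at_.
have -> : k t = f t * (G y - G t) + (F x - F t) * g t by rewrite /k /h; ring.
apply: le_trans (ler_normD _ _) _; rewrite !normrM mulrDl; apply: lerD.
  rewrite -mulrA; apply: ler_pM => //; first exact: fM.
  apply: le_trans (GB _ _ at_ ty yb) _.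
  by apply: ler_wpM2l => //; apply: lerB.
rewrite mulrAC; apply: ler_pM => //; last exact: gN.
rewrite distrC; apply: le_trans (FB _ _ ax xt tb) _.
by apply: ler_wpM2l => //; apply: lerB.
Qed.

(** By Lebesgue differentiation the primitive has derivative g almost everywhere, and it is
    constantly 0 near each interior point. The extension of g by 0 outside [a, b] makes it
    integrable on the whole line. *)
Lemma prim_eq0_ae g : bmr g -> (forall x, a <= x <= b -> prim g x = 0) ->
  aeI a b (fun t => g t = 0).
Proof.
move=> bg g0.
pose h := g \_ I.
have inth : mu.-integrable setT (EFin \o h).
  rewrite /h -restrict_EFin; apply/integrable_restrict => //=.
  by rewrite setTI; exact: bmr_integrable.
have inthS (A : set R) : measurable A -> mu.-integrable A (EFin \o h).
  by move=> mA; exact: (integrableS _ _ _ inth).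
have locf : locally_integrable setT h.
  split; first by have /integrableP[/measurable_EFinP] := inth.
    exact: openT.
  move=> K _ cK; have /integrableP[_] := inthS K (compact_measurable cK).
  by [].
have := @FTC1 R h (BLeft a) (fun y => inthS _ (measurable_itv _)) locf.
have H := @aeI_oo R a b (fun t => g t = 0); move=> F; apply/H.
move: F; apply: (@filterS _ _ (ae_filter_ringOfSetsType mu)) => t h1.
rewrite /= in_itv /= => /andP[at_ tb].
have aBt : (a%:E < (t : R)%:E)%E by rewrite lte_fin.
have [_] := h1 aBt.
have ht : h t = g t by rewrite /h patchE mem_set //= in_itv /= !ltW.
rewrite ht => <-.
rewrite derive1E (@near_eq_derive _ _ _ _ (cst 0)) ?derive_cst //.
near=> x.
have ax : a < x by near: x; exact: lt_nbhsr.
have xb : x < b by near: x; exact: lt_nbhsl.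
transitivity (prim g x); last by apply: g0; rewrite (ltW ax) (ltW xb).
apply: eq_Rintegral => s; rewrite inE /= in_itv /= => /andP[as_ sx].
by rewrite /h patchE mem_set //= in_itv /= as_ (le_trans sx) // ltW.
Unshelve. all: by end_near. Qed.

Lemma bmr_exp (l : R) : bmr (fun t => expR (l * (t - a))).
Proof.
have me : measurable_fun I (fun t : R => expR (l * (t - a))).
  apply: measurable_funTS; apply: measurableT_comp; first exact: measurable_expR.
  by apply: measurable_funM => //; exact: measurable_funB.
split => //; exists (expR (`|l| * (b - a))) => t /andP[at_ tb].
rewrite ger0_norm ?expR_ge0 // ler_expR.
apply: le_trans (ler_norm _) _; rewrite normrM ler_wpM2l //.
by rewrite ger0_norm ?subr_ge0 // lerB.
Qed.

Lemma prim_exp (l x : R) : 0 < l -> a <= x <= b ->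
  prim (fun t => expR (l * (t - a))) x = (expR (l * (x - a)) - 1) / l.
Proof.
move=> l0 /andP[]; rewrite le_eqVlt => /predU1P[<- _|ax xb].
  by rewrite prim0 subrr mulr0 expR0 subrr mul0r.
pose F (t : R) := expR (l * (t - a)) / l.
have dF (t : R) : is_derive t (1 : R) F (expR (l * (t - a))).
  rewrite /F; apply: is_derive_eq.
  rewrite /GRing.scale /= mulr0 add0r subr0 mulr1.
  by field; rewrite gt_eqF.
have cF : continuous F.
  by move=> t; apply: differentiable_continuous; apply/derivable1_diffP.
have E := @continuous_FTC2 R (fun t => expR (l * (t - a))) F a x ax.
rewrite /prim /Rintegral E /= /F.
- by rewrite subrr mulr0 expR0 mulrBl.
- apply: continuous_subspaceT => t.
  apply: continuous_comp; last exact: continuous_expR.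
  apply: differentiable_continuous; apply/derivable1_diffP; exact: ex_derive.
- split; first by move=> t _; exact: ex_derive.
    by apply: cvg_at_right_filter; exact: cF.
  by apply: cvg_at_left_filter; exact: cF.
- by move=> t _; rewrite derive1E derive_val.
Qed.

(** Integrating an exponential of rate l gains the factor 1 / l, the source of the contraction for
    Volterra equations. *)
Lemma prim_exp_bound g (M l x : R) : 0 < l -> bmr g -> a <= x <= b ->
  (forall t, a <= t <= x -> `|g t| <= M * expR (l * (t - a))) -> 0 <= M ->
  `|prim g x| <= M / l * expR (l * (x - a)).
Proof.
move=> l0 bg xI gM M0; have /andP[ax xb] := xI.
apply: le_trans (prim_norm_le bg (bmrZ M (bmr_exp l)) xb gM) _.
rewrite primZ //; last exact: bmr_exp.
rewrite prim_exp // -mulrA ler_wpM2l // mulrC ler_wpM2l ?invr_ge0 ?(ltW l0) //.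
by rewrite lerBlDr lerDl.
Qed.

End RealIntegral.

(** * The modulus of complex numbers *)

Section ComplexModulus.
Variable R : realType.
Implicit Types z w : C R.
Notation cRe := (@complex.Re R).
Notation cIm := (@complex.Im R).

Lemma cabsE z : cabs z = Normc.normc z.
Proof. by case: z. Qed.

Lemma cabs_ge0 z : 0 <= cabs z.
Proof. exact: sqrtr_ge0. Qed.

Lemma cabs0 : cabs (0 : C R) = 0.
Proof. by rewrite cabsE Normc.normc0. Qed.

Lemma cabs1 : cabs (1 : C R) = 1.
Proof. by rewrite cabsE Normc.normc1. Qed.

Lemma cabs_eq0 z : cabs z = 0 -> z = 0.
Proof. by rewrite cabsE => /Normc.eq0_normc. Qed.

Lemma cabsM z w : cabs (z * w) = cabs z * cabs w.
Proof. by rewrite !cabsE Normc.normcM. Qed.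

Lemma cabsD z w : cabs (z + w) <= cabs z + cabs w.
Proof. by rewrite !cabsE; exact: le_normcD. Qed.

Lemma cabsN z : cabs (- z) = cabs z.
Proof. by rewrite !cabsE; exact: normcN. Qed.

Lemma cabsB z w : cabs (z - w) <= cabs z + cabs w.
Proof. by rewrite -(cabsN w); exact: cabsD. Qed.

Lemma cabs_sum (J : Type) (r : seq J) (F : J -> C R) :
  cabs (\sum_(i <- r) F i) <= \sum_(i <- r) cabs (F i).
Proof.
elim: r => [|i r IH]; first by rewrite !big_nil cabs0.
by rewrite !big_cons (le_trans (cabsD _ _)) // lerD2l.
Qed.

Lemma ReIm_le_cabs z : `|cRe z| <= cabs z /\ `|cIm z| <= cabs z.
Proof.
by rewrite /cabs; split; rewrite -[leLHS]sqrtr_sqr ler_sqrt ?addr_ge0 ?sqr_ge0 //;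
  rewrite ?lerDl ?lerDr sqr_ge0.
Qed.

Lemma cabs_le_ReIm z : cabs z <= `|cRe z| + `|cIm z|.
Proof.
rewrite /cabs -[leRHS]ger0_norm ?addr_ge0 // -sqrtr_sqr ler_sqrt ?sqr_ge0 //.
rewrite -(real_normK (num_real (cRe z))) -(real_normK (num_real (cIm z))).
by rewrite sqrrD lerD2r lerDl mulrn_wge0 ?mulr_ge0.
Qed.

Lemma ReD z w : cRe (z + w) = cRe z + cRe w.
Proof. by case: z; case: w. Qed.

Lemma ImD z w : cIm (z + w) = cIm z + cIm w.
Proof. by case: z; case: w. Qed.

Lemma ReM z w : cRe (z * w) = cRe z * cRe w - cIm z * cIm w.
Proof. by case: z; case: w. Qed.

Lemma ImM z w : cIm (z * w) = cRe z * cIm w + cIm z * cRe w.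
Proof. by case: z; case: w. Qed.

Lemma complexP z w : cRe z = cRe w -> cIm z = cIm w -> z = w.
Proof. by case: z; case: w => ? ? ? ? /= -> ->. Qed.

End ComplexModulus.

(** * Complex primitives and the uniqueness of derivatives *)

Section ComplexPrimitive.
Variables (R : realType) (a b : R).
Hypothesis ab : a < b.
Notation I := [set` `[a, b]].
Notation cRe := (@complex.Re R).
Notation cIm := (@complex.Im R).
Notation "f =ae g" := (aeI a b (fun t => f t = g t)) (at level 70).
Implicit Types f g h y z : R -> C R.

Lemma ae_refl f : f =ae f. Proof. exact: aeI_all. Qed.

Lemma ae_sym f g : f =ae g -> g =ae f.
Proof. exact: aeI_sub. Qed.

Lemma ae_trans f g h : f =ae g -> g =ae h -> f =ae h.
Proof. by apply: aeI_sub2 => t _ -> ->. Qed.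

Definition bmc g := bmr a b (fun t => cRe (g t)) /\ bmr a b (fun t => cIm (g t)).

Definition cprim g (x : R) : C R := cint `[a, x] g.

Lemma Re_cprim g x : cRe (cprim g x) = prim a (fun t => cRe (g t)) x.
Proof. by []. Qed.

Lemma Im_cprim g x : cIm (cprim g x) = prim a (fun t => cIm (g t)) x.
Proof. by []. Qed.

Lemma bmc_bound g : bmc g ->
  exists2 M : R, 0 <= M & forall t, a <= t <= b -> cabs (g t) <= M.
Proof.
move=> [[_ [M gM]] [_ [N gN]]]; exists (`|M| + `|N|) => [|t tI].
  exact: addr_ge0.
apply: le_trans (cabs_le_ReIm _) _; apply: lerD.
- exact: le_trans (gM _ tI) (ler_norm _).
- exact: le_trans (gN _ tI) (ler_norm _).
Qed.

Lemma bmc_cst c : bmc (fun _ => c).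
Proof. by split; exact: bmr_cst. Qed.

Lemma bmcD f g : bmc f -> bmc g -> bmc (fun t => f t + g t).
Proof.
move=> [f1 f2] [g1 g2]; split.
- by under eq_fun do rewrite ReD; exact: bmrD.
- by under eq_fun do rewrite ImD; exact: bmrD.
Qed.

Lemma bmcM f g : bmc f -> bmc g -> bmc (fun t => f t * g t).
Proof.
move=> [f1 f2] [g1 g2]; split.
- by under eq_fun do rewrite ReM; apply: bmrB; exact: bmrM.
- by under eq_fun do rewrite ImM; apply: bmrD; exact: bmrM.
Qed.

Lemma bmcZ c g : bmc g -> bmc (fun t => c * g t).
Proof. exact/bmcM/bmc_cst. Qed.

Lemma bmcN g : bmc g -> bmc (fun t => - g t).
Proof.
by move=> /(bmcZ (- 1)); under eq_fun do rewrite mulN1r.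
Qed.

Lemma bmcB f g : bmc f -> bmc g -> bmc (fun t => f t - g t).
Proof. by move=> hf /bmcN; exact: bmcD. Qed.

Lemma bmc_cprim g : bmc g -> bmc (cprim g).
Proof. by move=> [g1 g2]; split; exact: bmr_prim. Qed.

Lemma bmc_sum (J : Type) (r : seq J) (F : J -> R -> C R) :
  (forall i, bmc (F i)) -> bmc (fun t => \sum_(i <- r) F i t).
Proof.
move=> hF; elim: r => [|i r IH].
  by under eq_fun do rewrite big_nil; exact: bmc_cst.
by under eq_fun do rewrite big_cons; exact: bmcD.
Qed.

Lemma cprim0 g : cprim g a = 0.
Proof. by apply: complexP; rewrite ?Re_cprim ?Im_cprim prim0. Qed.

Lemma cprimD f g x : bmc f -> bmc g -> x <= b ->
  cprim (fun t => f t + g t) x = cprim f x + cprim g x.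
Proof.
move=> [f1 f2] [g1 g2] xb; apply: complexP.
- rewrite ReD !Re_cprim; under eq_fun do rewrite ReD; exact: (primD ab).
- rewrite ImD !Im_cprim; under eq_fun do rewrite ImD; exact: (primD ab).
Qed.

Lemma cprimZ c g x : bmc g -> x <= b ->
  cprim (fun t => c * g t) x = c * cprim g x.
Proof.
move=> [g1 g2] xb; apply: complexP.
- rewrite ReM !Re_cprim Im_cprim; under eq_fun do rewrite ReM.
  by rewrite (primB ab) ?(primZ ab) //; exact: bmrZ.
- rewrite ImM Re_cprim !Im_cprim; under eq_fun do rewrite ImM.
  by rewrite (primD ab) ?(primZ ab) //; exact: bmrZ.
Qed.

Lemma cprimB f g x : bmc f -> bmc g -> x <= b ->
  cprim (fun t => f t - g t) x = cprim f x - cprim g x.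
Proof.
move=> hf hg xb.
have := cprimD hf (bmcZ (- 1) hg) xb; rewrite cprimZ // mulN1r => <-.
by congr (cprim _ x); apply/funext => t; rewrite mulN1r.
Qed.

Lemma cprim_ae f g x :
  measurable_fun I (fun t => cRe (f t)) -> measurable_fun I (fun t => cIm (f t)) ->
  measurable_fun I (fun t => cRe (g t)) -> measurable_fun I (fun t => cIm (g t)) ->
  x <= b -> f =ae g -> cprim f x = cprim g x.
Proof.
move=> f1 f2 g1 g2 xb fg; apply: complexP; rewrite ?Re_cprim ?Im_cprim;
  by apply: (prim_ae (b := b)) => //; apply: aeI_sub fg => t _ ->.
Qed.

(** The integral is defined part by part, so the modulus is estimated by the sum of the two parts;
    hence the factor 2. *)
Lemma cprim_diff_le g (x y M : R) : bmc g -> a <= x -> x <= y -> y <= b ->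
  (forall t, x <= t <= y -> cabs (g t) <= M) ->
  cabs (cprim g y - cprim g x) <= 2 * M * (y - x).
Proof.
move=> [g1 g2] ax xy yb gM; apply: le_trans (cabs_le_ReIm _) _.
have -> : cRe (cprim g y - cprim g x) =
    prim a (fun t => cRe (g t)) y - prim a (fun t => cRe (g t)) x by [].
have -> : cIm (cprim g y - cprim g x) =
    prim a (fun t => cIm (g t)) y - prim a (fun t => cIm (g t)) x by [].
rewrite -mulrA mulr_natl mulr2n; apply: lerD; apply: (prim_diff_le ab) => // t /gM.
- by apply: le_trans; case: (ReIm_le_cabs (g t)).
- by apply: le_trans; case: (ReIm_le_cabs (g t)).
Qed.

Lemma cprim_le g (x M : R) : bmc g -> a <= x <= b ->
  (forall t, a <= t <= b -> cabs (g t) <= M) ->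
  cabs (cprim g x) <= 2 * (b - a) * M.
Proof.
move=> bg /andP[ax xb] gM.
have M0 : 0 <= M by apply: le_trans (cabs_ge0 (g a)) (gM a _); rewrite lexx ltW.
have -> : cprim g x = cprim g x - cprim g a by rewrite cprim0 subr0.
apply: le_trans (cprim_diff_le bg (lexx _) ax xb (M := M) _) _.
  by move=> t /andP[at_ tx]; apply: gM; rewrite at_ (le_trans tx).
rewrite mulrAC ler_wpM2r // ler_wpM2l //; exact: lerB.
Qed.

Lemma cprim_exp_bound g (M l x : R) : 0 < l -> 0 <= M -> bmc g -> a <= x <= b ->
  (forall t, a <= t <= x -> cabs (g t) <= M * expR (l * (t - a))) ->
  cabs (cprim g x) <= 2 * M / l * expR (l * (x - a)).
Proof.
move=> l0 M0 [g1 g2] xI gM; apply: le_trans (cabs_le_ReIm _) _.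
rewrite Re_cprim Im_cprim -!mulrA mulr_natl mulr2n mulrA; apply: lerD.
- apply: (prim_exp_bound ab) => // t /gM; apply: le_trans.
  by case: (ReIm_le_cabs (g t)).
- apply: (prim_exp_bound ab) => // t /gM; apply: le_trans.
  by case: (ReIm_le_cabs (g t)).
Qed.

Lemma cprimM c d f g x : bmc f -> bmc g -> a <= x <= b ->
  (c + cprim f x) * (d + cprim g x) =
  c * d + cprim (fun t => f t * (d + cprim g t) + (c + cprim f t) * g t) x.
Proof.
move=> [f1 f2] [g1 g2] xI; have /andP[ax xb] := xI.
have bp (c1 : R) (h : R -> R) : bmr a b h -> bmr a b (fun t => c1 + prim a h t).
  by move=> bh; apply: bmrD; [exact: bmr_cst|exact: bmr_prim].
have bq (c1 : R) (h : R -> R) (c2 : R) (k : R -> R) : bmr a b h -> bmr a b k ->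
    bmr a b (fun t => h t * (c2 + prim a k t) + (c1 + prim a h t) * k t).
  by move=> bh bk; apply: bmrD; apply: bmrM => //; exact: bp.
apply: complexP.
- rewrite ReD !ReM !ReD !ImD !Re_cprim !Im_cprim.
  rewrite (primM ab _ _ f1 g1 xI) (primM ab _ _ f2 g2 xI).
  rewrite opprD addrACA -(primB ab) //; try exact: bq.
  by congr (_ + prim a _ x); apply/funext => t; rewrite ReD !ReM !ReD !ImD !Re_cprim !Im_cprim; ring.
- rewrite ImD !ImM !ReD !ImD !Re_cprim !Im_cprim.
  rewrite (primM ab _ _ f1 g2 xI) (primM ab _ _ f2 g1 xI).
  rewrite addrACA -(primD ab) //; try exact: bq.
  by congr (_ + prim a _ x); apply/funext => t; rewrite ImD !ImM !ReD !ImD !Re_cprim !Im_cprim; ring.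
Qed.

(** The difference D of the two sides is Lipschitz and vanishes almost everywhere, hence everywhere.
    Its value at a gives c = d, and a vanishing primitive has an almost everywhere vanishing
    integrand. *)
Lemma cprim_ae_inj c d f g : bmc f -> bmc g ->
  (fun t => c + cprim f t) =ae (fun t => d + cprim g t) -> c = d /\ f =ae g.
Proof.
move=> bf bg E; have bfg := bmcB bf bg.
have [M M0 hM] := bmc_bound bfg.
pose D x := (c - d) + cprim (fun t => f t - g t) x.
have D0ae : aeI a b (fun t => D t = 0).
  apply: aeI_sub E => t /andP[_ tb] Et.
  by rewrite /D cprimB // addrACA -opprD Et subrr.
have DL u v : a <= u -> u <= v -> v <= b -> cabs (D v - D u) <= 2 * M * (v - u).
  move=> au uv vb; rewrite /D opprD addrACA subrr add0r.
  apply: cprim_diff_le => // t /andP[ut tv]; apply: hM.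
  by rewrite (le_trans au ut) (le_trans tv vb).
have D0 x : a <= x <= b -> D x = 0.
  move=> /andP[ax xb]; apply: cabs_eq0; apply/eqP; rewrite eq_le cabs_ge0 andbT.
  apply/ler_addgt0Pr => e e0; rewrite add0r.
  have K0 : 0 < 2 * M + 1 by apply: ltr_wpDl => //; exact: mulr_ge0.
  pose r := e / (2 * M + 1).
  have r0 : 0 < r by rewrite divr_gt0.
  have Kr : 2 * M * r <= e.
    by rewrite mulrA ler_pdivrMr // mulrC ler_wpM2l ?(ltW e0) // lerDl.
  (* A zero of D at distance less than r to the right of x, or to the left when x = b, gives |D x|
     <= 2 M r <= e. *)
  have [xlb|bx] := ltP x b.
    have [||t [/andP[xt tm] Dt]] := @aeI_exists R a b _ x (Num.min b (x + r)) ax _ _ D0ae.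
    - by rewrite lt_min xlb ltrDl.
    - by rewrite ge_min lexx.
    move: tm; rewrite lt_min => /andP[tb tr].
    rewrite -[D x]subr0 -Dt -cabsN opprB; apply: le_trans Kr.
    apply: le_trans (DL _ _ ax (ltW xt) (ltW tb)) _.
    by apply: ler_wpM2l; [exact: mulr_ge0|rewrite lerBlDl ltW].
  have {bx}xb' : x = b by apply/eqP; rewrite eq_le xb.
  have alx : a < x by rewrite xb'.
  have [||t [/andP[mt tx] Dt]] := @aeI_exists R a b _ (Num.max a (x - r)) x _ _ xb D0ae.
  - by rewrite le_max lexx.
  - by rewrite gt_max alx ltrBlDr ltrDl.
  move: mt; rewrite gt_max => /andP[at_ tr].
  rewrite -[D x]subr0 -Dt; apply: le_trans Kr.
  apply: le_trans (DL _ _ (ltW at_) (ltW tx) xb) _.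
  by apply: ler_wpM2l; [exact: mulr_ge0|rewrite lerBlDr -lerBlDl ltW].
have cd : c = d.
  have := D0 a; rewrite /D cprim0 addr0 lexx ltW // => /(_ isT) /eqP.
  by rewrite subr_eq0 => /eqP.
split=> //.
have P0 x : a <= x <= b -> cprim (fun t => f t - g t) x = 0.
  by move=> /D0; rewrite /D cd subrr add0r.
have [b1 b2] := bfg.
have h1 := prim_eq0_ae ab b1 (fun x xI => congr1 cRe (P0 x xI)).
have h2 := prim_eq0_ae ab b2 (fun x xI => congr1 cIm (P0 x xI)).
apply: aeI_sub2 h1 h2 => t _ e1 e2.
by apply/eqP; rewrite -subr_eq0; apply/eqP; exact: complexP.
Qed.

End ComplexPrimitive.

(** * Sobolev norms by recursion on the order *)

(** Arithmetic of one induction step for products in W^k. Y and Y' stand for the norms of order k +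
    1 of the factors, y and y' for those of order k, l and l' for the sup norms, Z and Z' for the
    norms of the derivatives, s1 and s2 for the Leibniz terms. The bounds p l Y', p Z Y' and p Y Z'
    are completed by p Y l' to 2 p Y Y'. *)
Lemma leibniz_bound (R : realFieldType) (p Y Y' Z Z' y y' l l' n s1 s2 s : R) :
  1 <= p -> 0 <= Z -> 0 <= Z' -> 0 <= y -> 0 <= y' -> 0 <= l -> 0 <= l' ->
  Y = l + Z -> Y' = l' + Z' -> y <= Y -> y' <= Y' -> n <= l * l' ->
  s1 <= p * Z * y' -> s2 <= p * y * Z' -> s <= s1 + s2 ->
  n + s <= 2 * p * Y * Y'.
Proof.
move=> p1 Z0 Z0' y0 y0' l0 l0' eY eY' yY yY' nl h1 h2 h3.
have p0 : 0 <= p by exact: le_trans p1.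
have Y0 : 0 <= Y by exact: le_trans yY.
have Y0' : 0 <= Y' by exact: le_trans yY'.
have g1 : s1 <= p * Z * Y' by rewrite (le_trans h1) // ler_wpM2l // mulr_ge0.
have g2 : s2 <= p * Y * Z'.
  by rewrite (le_trans h2) // ler_wpM2r // ler_wpM2l.
have lY' : l' <= Y' by rewrite eY' lerDl.
have g3 : n <= p * l * Y'.
  rewrite (le_trans nl) // -mulrA (@le_trans _ _ (l * Y')) ?ler_wpM2l //.
  by rewrite ler_peMl // mulr_ge0.
have -> : 2 * p * Y * Y' = (p * l * Y' + (p * Z * Y' + p * Y * Z')) + p * Y * l'.
  by rewrite eY' eY; ring.
rewrite -[leLHS]addr0; apply: lerD; last by rewrite !mulr_ge0.
apply: lerD => //; apply: le_trans h3 _; exact: lerD.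
Qed.

Section SobolevRecursion.
Variables (R : realType) (a b : R).
Hypothesis ab : a < b.
Notation I := [set` `[a, b]].
Notation cRe := (@complex.Re R).
Notation cIm := (@complex.Im R).
Notation "f =ae g" := (aeI a b (fun t => f t = g t)) (at level 70).
Implicit Types f g h y z : R -> C R.

(** L_infty in terms of a representative bounded everywhere; [inW0P] identifies it with [inW] of
    order 0. *)
Definition W0 g := exists2 h, bmc a b h & g =ae h.

Lemma bmc_W0 g : bmc a b g -> W0 g.
Proof. by move=> bg; exists g => //; exact: ae_refl. Qed.

Lemma W0_bound g : W0 g ->
  exists2 M : R, 0 <= M & aeI a b (fun t => cabs (g t) <= M).
Proof.
move=> [h bh gh]; have [M M0 hM] := bmc_bound bh; exists M => //.
by apply: aeI_sub gh => t tI ->; exact: hM.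
Qed.

Lemma linf_ge0 g : 0 <= linf a b g.
Proof.
rewrite /linf; set E := [set _ | _].
(* Without any essential bound the set is empty, and its infimum is 0 by convention. *)
have [->|/set0P E0] := eqVneq E set0; first by rewrite inf0.
by apply: lb_le_inf => // x [].
Qed.

Lemma linf_le g (M : R) : 0 <= M -> aeI a b (fun t => cabs (g t) <= M) ->
  linf a b g <= M.
Proof. by move=> M0 gM; apply: ge_inf; [exists 0 => x []|split]. Qed.

(** The infimum is attained: the bounds inf + 1 / (k + 1) hold simultaneously outside a countable
    union of null sets. *)
Lemma linf_ub g : W0 g -> aeI a b (fun t => cabs (g t) <= linf a b g).
Proof.
move=> /W0_bound[M M0 gM]; rewrite /linf; set E := [set _ | _].
have hE : has_inf E by split; [exists M; split|exists 0 => x []].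
have H k : aeI a b (fun t => cabs (g t) <= inf E + k.+1%:R^-1).
  have [|e [e0 ge] eE] := @inf_adherent R E k.+1%:R^-1 _ hE; first by rewrite invr_gt0.
  by apply: aeI_sub ge => t _ h; exact: le_trans h (ltW eE).
apply: aeI_sub (aeI_nat H) => t _ h; apply/ler_addgt0Pr => e e0.
have N := truncnS_gt e^-1.
apply: le_trans (h (Num.truncn e^-1)) _; rewrite lerD2l.
by rewrite -[leRHS]invrK lef_pV2 ?posrE ?invr_gt0 // ltW.
Qed.

Lemma linf_ae f g : f =ae g -> linf a b f = linf a b g.
Proof.
move=> fg; rewrite /linf; congr inf; apply/seteqP; split => M [M0 h]; split => //.
- by apply: aeI_sub2 fg h => t _ ->.
- by apply: aeI_sub2 fg h => t _ ->.
Qed.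

(* Clipping real and imaginary parts separately keeps measurability obvious, at
   the price of a bound on the two parts rather than on the modulus. *)
Lemma clip g (M : R) : measurable_fun I (fun t => cRe (g t)) ->
  measurable_fun I (fun t => cIm (g t)) ->
  0 <= M -> aeI a b (fun t => cabs (g t) <= M) ->
  exists h, [/\ bmc a b h, g =ae h &
    forall t, `|cRe (h t)| <= M /\ `|cIm (h t)| <= M].
Proof.
move=> m1 m2 M0 gM.
pose cl (x : R) := Num.max (- M) (Num.min M x).
have clM x : `|cl x| <= M.
  rewrite ler_norml /cl le_max lexx /= ge_max ge_min lexx /= andbT.
  by rewrite (le_trans _ M0) // oppr_le0.
have clE x : `|x| <= M -> cl x = x.
  by rewrite ler_norml => /andP[h1 h2]; rewrite /cl (min_idPr h2) (max_idPr h1).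
have mcl (u : R -> R) : measurable_fun I u -> bmr a b (fun t => cl (u t)).
  move=> mu; split; last by exists M.
  by apply: measurable_maxr => //; exact: measurable_minr.
exists (fun t => Complex (cl (cRe (g t))) (cl (cIm (g t)))); split.
- by split; exact: mcl.
- apply: aeI_sub gM => t _ h; have [h1 h2] := ReIm_le_cabs (g t).
  by apply: complexP; rewrite /= clE // (le_trans _ h).
- by move=> t /=.
Qed.

Lemma ess_bdd_bmc g : ess_bdd a b g -> exists2 h, bmc a b h & g =ae h.
Proof.
move=> [m1 [m2 [M gM]]].
have [||h [bh gh _]] := @clip g `|M| m1 m2; first exact: normr_ge0.
  by apply: aeI_sub gM => t _ h; exact: le_trans h (ler_norm _).
by exists h.
Qed.

Lemma bmc_ess_bdd g : bmc a b g -> ess_bdd a b g.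
Proof.
move=> bg; have [M M0 gM] := bmc_bound bg; case: bg => [[m1 _] [m2 _]].
by split=> //; split=> //; exists M; exact: aeI_all.
Qed.

(** The bound holds only almost everywhere. Passing to a clipped representative doubles the constant
    of [cprim_le], because clipping controls the two parts separately. *)
Lemma cprim_le_ae g (M x : R) : bmc a b g -> 0 <= M ->
  aeI a b (fun t => cabs (g t) <= M) -> a <= x <= b ->
  cabs (cprim a g x) <= 4 * (b - a) * M.
Proof.
move=> [[m1 _] [m2 _]] M0 gM xI; have /andP[_ xb] := xI.
have [h [bh gh hM]] := clip m1 m2 M0 gM.
have [[n1 _] [n2 _]] := bh.
rewrite (cprim_ae m1 m2 n1 n2 xb gh).
have -> : 4 * (b - a) * M = 2 * (b - a) * (M + M) by ring.
apply: (cprim_le ab) => // t _; apply: le_trans (cabs_le_ReIm _) _.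
by have [? ?] := hM t; exact: lerD.
Qed.

(* z is a bounded measurable weak derivative of y, and c is the value at a of the
   continuous representative of y. *)
Definition prs (c : C R) z y := bmc a b z /\ y =ae (fun t => c + cprim a z t).

Lemma prs_inj c c' z z' y y' : y =ae y' -> prs c z y -> prs c' z' y' ->
  c = c' /\ z =ae z'.
Proof.
move=> e [bz yz] [bz' yz']; apply: (cprim_ae_inj ab) => //.
exact: ae_trans (ae_sym yz) (ae_trans e yz').
Qed.

Lemma bmc_affine c z : bmc a b z -> bmc a b (fun t => c + cprim a z t).
Proof. by move=> bz; apply: bmcD; [exact: bmc_cst|exact: bmc_cprim]. Qed.

Lemma prs_W0 c z y : prs c z y -> W0 y.
Proof. by move=> [bz yz]; exists (fun t => c + cprim a z t) => //; exact: bmc_affine. Qed.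

(** Peeling off the lowest derivative, exchanged for a bounded representative, turns chains into a
    recursion on the order. *)
Lemma deriv_chainS k y d : deriv_chain a b k.+1 y d ->
  exists c z, [/\ prs c z y, d 1%N =ae z & deriv_chain a b k z (fun j => d j.+1)].
Proof.
move=> [dy [bd id]].
have [z bz dz] := ess_bdd_bmc (bd 1%N isT).
exists (d 0%N a), z; split=> //.
- split=> //; apply: ae_trans (ae_sym dy) _; apply: aeI_all => x xI.
  rewrite (id 0%N isT); last by rewrite /= in_itv.
  have [m1 [m2 _]] := bd 1%N isT; have [[n1 _] [n2 _]] := bz.
  by have /andP[_ xb] := xI; rewrite -(cprim_ae m1 m2 n1 n2 xb dz).
- by split=> //; split=> j jk; [exact: bd|exact: id].
Qed.

(** The entry of index 0 is the continuous representative rather than y, since a chain demands the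
    integral identity at every point. *)
Lemma deriv_chain_cons k c z y d : prs c z y -> deriv_chain a b k z d ->
  deriv_chain a b k.+1 y (fun j => if j is j'.+1 then d j' else fun t => c + cprim a z t).
Proof.
move=> [bz yz] [dz [bd id]]; split; first exact: ae_sym.
split=> [[_|j jk]|[_|j jk]].
- by apply: bmc_ess_bdd; exact: bmc_affine.
- exact: bd.
- move=> x; rewrite /= in_itv /= => xI; have /andP[_ xb] := xI.
  rewrite cprim0 addr0; congr (_ + _).
  have [m1 [m2 _]] := bd 0%N isT; have [[n1 _] [n2 _]] := bz.
  exact: (cprim_ae n1 n2 m1 m2 xb (ae_sym dz)).
- exact: id.
Qed.

(** This frees [sobnorm], and [vderiv] up to null sets, from the arbitrary choice made in
    [dchain]. *)
Lemma deriv_chain_uniq k y y' d d' : y =ae y' ->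
  deriv_chain a b k y d -> deriv_chain a b k y' d' ->
  forall j, (j <= k)%N -> d j =ae d' j.
Proof.
elim: k y y' d d' => [|k IH] y y' d d' e cd cd' [|j] //.
- by move=> _; case: cd cd' => [h _] [h' _]; exact: ae_trans h (ae_trans e (ae_sym h')).
- by move=> _; case: cd cd' => [h _] [h' _]; exact: ae_trans h (ae_trans e (ae_sym h')).
- move=> jk; have [c [z [pz _ dz]]] := deriv_chainS cd.
  have [c' [z' [pz' _ dz']]] := deriv_chainS cd'.
  have [_ zz] := prs_inj e pz pz'.
  exact: (IH _ _ _ _ zz dz dz').
Qed.

Lemma dchainP k y : inW a b k y -> deriv_chain a b k y (dchain a b k y).
Proof. by rewrite /dchain => h; case: pselect => // P; exact: projT2 (cid P). Qed.

Lemma sobnorm_chain k y d : deriv_chain a b k y d ->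
  sobnorm a b k y = \sum_(j < k.+1) linf a b (d j).
Proof.
move=> cd; apply: eq_bigr => j _; apply: linf_ae.
have := dchainP (ex_intro _ d cd); move/deriv_chain_uniq; apply; last exact: leq_ord.
  exact: ae_refl.
exact: cd.
Qed.

Lemma sobnorm_ge0 k y : 0 <= sobnorm a b k y.
Proof. by apply: sumr_ge0 => j _; exact: linf_ge0. Qed.

Lemma deriv_chain0 y : W0 y -> exists2 h, y =ae h & deriv_chain a b 0 y (fun=> h).
Proof.
move=> [h bh yh]; exists h => //; split; first exact: ae_sym.
by split=> // j _; exact: bmc_ess_bdd.
Qed.

Lemma inW0P y : inW a b 0 y <-> W0 y.
Proof.
split; last by move=> /deriv_chain0[h _ ch]; exists (fun=> h).
move=> [d [dy [bd _]]]; have [h bh dh] := ess_bdd_bmc (bd 0%N isT).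
by exists h => //; exact: ae_trans (ae_sym dy) dh.
Qed.

Lemma sobnorm0E y : W0 y -> sobnorm a b 0 y = linf a b y.
Proof.
move=> /deriv_chain0[h yh ch]; rewrite (sobnorm_chain ch) big_ord1.
exact: linf_ae (ae_sym yh).
Qed.

Lemma inWS_elim k y : inW a b k.+1 y -> exists c z, prs c z y /\ inW a b k z.
Proof.
move=> [d /deriv_chainS[c [z [pz _ dz]]]]; exists c, z; split=> //.
by exists (fun j => d j.+1).
Qed.

Lemma inWS k c z y : prs c z y -> inW a b k z -> inW a b k.+1 y.
Proof. by move=> pz [d /(deriv_chain_cons pz)]; eexists; eassumption. Qed.

Lemma sobnormS k c z y : prs c z y -> inW a b k z ->
  sobnorm a b k.+1 y = linf a b y + sobnorm a b k z.
Proof.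
move=> pz [d dz]; rewrite (sobnorm_chain (deriv_chain_cons pz dz)).
rewrite big_ord_recl /=; congr (_ + _); last by rewrite (sobnorm_chain dz).
by apply: linf_ae; apply: ae_sym; case: pz.
Qed.

Lemma deriv_chain_ae k y y' d : y =ae y' -> deriv_chain a b k y d ->
  deriv_chain a b k y' d.
Proof. by move=> e [dy h]; split=> //; exact: ae_trans dy e. Qed.

Lemma inW_ae k y y' : y =ae y' -> inW a b k y -> inW a b k y'.
Proof. by move=> e [d cd]; exists d; exact: deriv_chain_ae e cd. Qed.

Lemma sobnorm_ae k y y' : y =ae y' -> inW a b k y ->
  sobnorm a b k y' = sobnorm a b k y.
Proof.
move=> e [d cd]; rewrite (sobnorm_chain cd).
by rewrite (sobnorm_chain (deriv_chain_ae e cd)).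
Qed.

(** [vderiv] reads the derivative off a chain of order 1 whatever the order of the function, so that
    choice has to be compared with z. *)
Lemma dchain1 c z y : prs c z y -> dchain a b 1 y 1%N =ae z.
Proof.
move=> pz; have bz : W0 z by apply: bmc_W0; case: pz.
have [h zh ch] := deriv_chain0 bz.
have cy := deriv_chain_cons pz ch.
have := deriv_chain_uniq (ae_refl _ _ y) (dchainP (ex_intro _ _ cy)) cy (leqnn 1).
by move=> e; apply: ae_trans e (ae_sym zh).
Qed.

Lemma inW_W0 k y : inW a b k y -> W0 y.
Proof.
by case: k => [/inW0P//|k /inWS_elim[c [z [pz _]]]]; exact: prs_W0 pz.
Qed.

Lemma linf_le_sobnorm k y : inW a b k y -> linf a b y <= sobnorm a b k y.
Proof.
case: k => [/inW0P h|k /inWS_elim[c [z [pz hz]]]]; first by rewrite sobnorm0E.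
by rewrite (sobnormS pz hz) lerDl sobnorm_ge0.
Qed.

Lemma prs_lin (l c c' : C R) z z' y y' : prs c z y -> prs c' z' y' ->
  prs (l * c + c') (fun t => l * z t + z' t) (fun t => l * y t + y' t).
Proof.
move=> [bz yz] [bz' yz']; split; first by apply: bmcD => //; exact: bmcZ.
apply: aeI_sub2 yz yz' => t /andP[_ tb] -> ->.
by rewrite (cprimD ab) ?(cprimZ ab) //; [rewrite mulrDr; ring|exact: bmcZ].
Qed.

Lemma W0_lin (l : C R) y y' : W0 y -> W0 y' -> W0 (fun t => l * y t + y' t).
Proof.
move=> [h bh yh] [h' bh' yh']; exists (fun t => l * h t + h' t).
  by apply: bmcD => //; exact: bmcZ.
by apply: aeI_sub2 yh yh' => t _ -> ->.
Qed.

Lemma linf_lin (l : C R) y y' : W0 y -> W0 y' ->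
  linf a b (fun t => l * y t + y' t) <= cabs l * linf a b y + linf a b y'.
Proof.
move=> hy hy'; apply: linf_le.
  by rewrite addr_ge0 ?mulr_ge0 ?linf_ge0 ?cabs_ge0.
apply: aeI_sub2 (linf_ub hy) (linf_ub hy') => t _ h1 h2.
apply: le_trans (cabsD _ _) _; apply: lerD => //.
by rewrite cabsM ler_wpM2l ?cabs_ge0.
Qed.

Lemma inW_lin k (l : C R) y y' : inW a b k y -> inW a b k y' ->
  inW a b k (fun t => l * y t + y' t).
Proof.
elim: k y y' => [|k IH] y y'; first by move=> /inW0P h /inW0P h'; apply/inW0P; exact: W0_lin.
move=> /inWS_elim[c [z [pz hz]]] /inWS_elim[c' [z' [pz' hz']]].
exact: inWS (prs_lin l pz pz') (IH _ _ hz hz').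
Qed.

Lemma sobnorm_lin k (l : C R) y y' : inW a b k y -> inW a b k y' ->
  sobnorm a b k (fun t => l * y t + y' t) <=
  cabs l * sobnorm a b k y + sobnorm a b k y'.
Proof.
elim: k y y' => [|k IH] y y'.
  by move=> /inW0P h /inW0P h'; rewrite !sobnorm0E //; [exact: linf_lin|exact: W0_lin].
move=> /inWS_elim[c [z [pz hz]]] /inWS_elim[c' [z' [pz' hz']]].
rewrite (sobnormS (prs_lin l pz pz') (inW_lin l hz hz')) (sobnormS pz hz) (sobnormS pz' hz').
have := linf_lin l (prs_W0 pz) (prs_W0 pz'); have := IH _ _ hz hz'.
rewrite mulrDr addrACA => h1 h2; exact: lerD.
Qed.

Lemma inW_mono k y : inW a b k.+1 y -> inW a b k y.
Proof.
elim: k y => [|k IH] y /inWS_elim[c [z [pz hz]]]; first by apply/inW0P; exact: prs_W0 pz.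
exact: inWS pz (IH _ hz).
Qed.

Lemma sobnorm_mono k y : inW a b k.+1 y -> sobnorm a b k y <= sobnorm a b k.+1 y.
Proof.
elim: k y => [|k IH] y /inWS_elim[c [z [pz hz]]].
  by rewrite (sobnormS pz hz) sobnorm0E ?lerDl ?sobnorm_ge0 //; exact: prs_W0 pz.
rewrite (sobnormS pz hz) (sobnormS pz (inW_mono hz)) lerD2l; exact: IH.
Qed.

Lemma inW_cst k (c : C R) : inW a b k (fun=> c).
Proof.
elim: k c => [|k IH] c; first by apply/inW0P/bmc_W0; exact: bmc_cst.
apply: (@inWS k c (fun=> 0)) => //; split; first exact: bmc_cst.
apply: aeI_all => t /andP[_ tb].
have := cprimZ ab 0 (bmc_cst a b 0) tb.
under eq_fun do rewrite mul0r.
by move=> ->; rewrite mul0r addr0.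
Qed.

(** The Leibniz rule, with the continuous representatives in place of y and y' so that the
    derivative is bounded everywhere, as [prs] demands. *)
Lemma prs_mul (c c' : C R) z z' y y' : prs c z y -> prs c' z' y' ->
  prs (c * c') (fun t => z t * (c' + cprim a z' t) + (c + cprim a z t) * z' t)
    (fun t => y t * y' t).
Proof.
move=> [bz yz] [bz' yz']; split.
  by apply: bmcD; apply: bmcM => //; exact: bmc_affine.
by apply: aeI_sub2 yz yz' => t tI -> ->; exact: (cprimM ab).
Qed.

Lemma W0_mul y y' : W0 y -> W0 y' -> W0 (fun t => y t * y' t).
Proof.
move=> [h bh yh] [h' bh' yh']; exists (fun t => h t * h' t); first exact: bmcM.
by apply: aeI_sub2 yh yh' => t _ -> ->.
Qed.

Lemma linf_mul y y' : W0 y -> W0 y' ->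
  linf a b (fun t => y t * y' t) <= linf a b y * linf a b y'.
Proof.
move=> hy hy'; apply: linf_le; first by rewrite mulr_ge0 ?linf_ge0.
apply: aeI_sub2 (linf_ub hy) (linf_ub hy') => t _ h1 h2.
by rewrite cabsM ler_pM ?cabs_ge0.
Qed.

(** Each application of the Leibniz rule doubles the constant, whence 2^k. *)
Lemma sobnorm_mul k y y' : inW a b k y -> inW a b k y' ->
  inW a b k (fun t => y t * y' t) /\
  sobnorm a b k (fun t => y t * y' t) <= 2 ^+ k * sobnorm a b k y * sobnorm a b k y'.
Proof.
elim: k y y' => [|k IH] y y'.
  move=> /inW0P h /inW0P h'; have H := W0_mul h h'; split; first exact/inW0P.
  by rewrite !sobnorm0E // expr0 mul1r; exact: linf_mul.
move=> hy hy'; have := hy; have := hy'.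
move=> /inWS_elim[c' [z' [pz' hz']]] /inWS_elim[c [z [pz hz]]].
have pm := prs_mul pz pz'; set w := (X in prs _ X _) in pm.
have [w1 s1] := IH _ _ hz (inW_mono hy').
have [w2 s2] := IH _ _ (inW_mono hy) hz'.
have we : (fun t => 1 * (z t * y' t) + y t * z' t) =ae w.
  have [_ e1] := pz; have [_ e2] := pz'.
  by apply: aeI_sub2 e1 e2 => t _ E1 E2; rewrite mul1r /w -E1 -E2.
have hs := inW_lin 1 w1 w2; have hw := inW_ae we hs.
split; first exact: inWS pm hw.
have N := linf_mul (inW_W0 hy) (inW_W0 hy').
have L := sobnorm_lin 1 w1 w2; rewrite cabs1 mul1r -(sobnorm_ae we hs) in L.
rewrite (sobnormS pm hw).
have m1 := sobnorm_mono hy; have m2 := sobnorm_mono hy'.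
have E1 := sobnormS pz hz; have E2 := sobnormS pz' hz'.
have p0 : 1 <= (2 : R) ^+ k by rewrite exprn_ege1 // ler1n.
rewrite exprS; apply: (leibniz_bound p0 (sobnorm_ge0 _ _) (sobnorm_ge0 _ _) (sobnorm_ge0 _ _)
  (sobnorm_ge0 _ _) (linf_ge0 _) (linf_ge0 _) E1 E2 m1 m2 N s1 s2 L).
Qed.

(** Evaluate y at a point where the almost-everywhere relations hold. With [linf_prs_le] this makes
    |y|_(k+1) equivalent to |c| + |z|_k, which is how completeness passes from order k to k + 1. *)
Lemma cabs_init_le c z y : prs c z y ->
  cabs c <= linf a b y + 4 * (b - a) * linf a b z.
Proof.
move=> pz; have [bz yz] := pz.
have H := aeI_and yz (linf_ub (prs_W0 pz)).
have [t [/andP[at_ tb] [e h]]] := aeI_exists (lexx a) ab (lexx b) H.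
have -> : c = y t - cprim a z t by rewrite e addrK.
apply: le_trans (cabsB _ _) _; apply: lerD => //.
apply: cprim_le_ae => //; first exact: linf_ge0.
  by apply: linf_ub; exact: bmc_W0.
by rewrite (ltW at_) (ltW tb).
Qed.

Lemma linf_prs_le c z y : prs c z y ->
  linf a b y <= cabs c + 4 * (b - a) * linf a b z.
Proof.
move=> pz; have [bz yz] := pz; apply: linf_le.
  by rewrite addr_ge0 ?cabs_ge0 // !mulr_ge0 ?linf_ge0 // subr_ge0 ltW.
apply: aeI_sub yz => t tI ->; apply: le_trans (cabsD _ _) _; rewrite lerD2l.
apply: cprim_le_ae => //; first exact: linf_ge0.
by apply: linf_ub; exact: bmc_W0.
Qed.

End SobolevRecursion.

(** * Completeness *)

Section GeometricSeries.
Variable R : realType.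

(** The subtracted term closes the induction on j: the next summand, at most K th^(N + j), fits into
    2 K th^(N + j) - 2 K th^(N + j + 1) because th <= 1/2. *)
Lemma geometric_tail (v : nat -> R) (K th : R) : 0 < th <= 2^-1 -> 0 <= K ->
  (forall i, `|v i| <= K * th ^+ i) ->
  forall N j, `|\sum_(i < N + j) v i - \sum_(i < N) v i| <=
    2 * K * th ^+ N - 2 * K * th ^+ (N + j).
Proof.
move=> /andP[th0 th1] K0 hv N; elim=> [|j IH]; first by rewrite addn0 !subrr normr0.
rewrite addnS big_ord_recr /= addrAC; apply: le_trans (ler_normD _ _) _.
apply: le_trans (lerD IH (hv _)) _; rewrite exprS.
have p0 : 0 <= K * th ^+ (N + j) by rewrite mulr_ge0 ?exprn_ge0 ?(ltW th0).
have : th * (K * th ^+ (N + j)) <= 2^-1 * (K * th ^+ (N + j)) by rewrite ler_wpM2r.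
rewrite !mulrA [th * K]mulrC => h.
have -> : 2 * K * th * th ^+ (N + j) = 2 * (K * th * th ^+ (N + j)) by ring.
by rewrite -!mulrA in h *; move: (K * _) (K * _) h => A B h; lra.
Qed.

Lemma geometric_cvg (v : nat -> R) (K th : R) : 0 < th <= 2^-1 -> 0 <= K ->
  (forall i, `|v i| <= K * th ^+ i) ->
  exists l : R, (fun N => \sum_(i < N) v i) @ \oo --> l /\
    forall N, `|l - \sum_(i < N) v i| <= 2 * K * th ^+ N.
Proof.
move=> th01 K0 hv; have /andP[th0 th1] := th01.
have cv : cvgn (series v).
  apply: normed_cvg; apply: (@series_le_cvg _ _ (geometric K th)) => //.
    by move=> n; exact: normr_ge0.
    by move=> n; rewrite /geometric /= mulr_ge0 // exprn_ge0 // ltW.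
  apply: is_cvg_geometric_series; rewrite gtr0_norm //; apply: le_lt_trans th1 _.
  by rewrite invf_lt1 ?ltr1n.
have sE : series v = (fun N => \sum_(i < N) v i).
  by apply/funext => N; rewrite /series /= big_mkord.
move: cv; rewrite sE => cv; exists (limn (fun N => \sum_(i < N) v i)); split=> // N.
set l := limn _; apply/ler_addgt0Pr => e e0.
have /cvgrPdist_lt/(_ _ e0)[M _ hM] := cv.
have := hM (N + M)%N (leq_addl _ _) => /= h.
have -> : l - \sum_(i < N) v i = (l - \sum_(i < N + M) v i) +
   (\sum_(i < N + M) v i - \sum_(i < N) v i) by rewrite addrA subrK.
apply: le_trans (ler_normD _ _) _; rewrite addrC; apply: lerD; last exact: ltW.
apply: le_trans (geometric_tail th01 K0 hv N M) _.
by rewrite lerBlDr lerDl !mulr_ge0 // exprn_ge0 // ltW.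
Qed.

End GeometricSeries.

Section Completeness.
Variables (R : realType) (a b : R).
Hypothesis ab : a < b.
Notation I := [set` `[a, b]].
Notation cRe := (@complex.Re R).
Notation cIm := (@complex.Im R).
Notation "f =ae g" := (aeI a b (fun t => f t = g t)) (at level 70).

Lemma bmr_series (u : nat -> R -> R) (K th : R) : 0 < th <= 2^-1 -> 0 <= K ->
  (forall i, bmr a b (u i)) ->
  (forall i t, a <= t <= b -> `|u i t| <= K * th ^+ i) ->
  exists y, bmr a b y /\
    forall N t, a <= t <= b -> `|y t - \sum_(i < N) u i t| <= 2 * K * th ^+ N.
Proof.
move=> th01 K0 bu hu.
have ex t : exists l : R, a <= t <= b -> (fun N => \sum_(i < N) u i t) @ \oo --> l /\
    forall N, `|l - \sum_(i < N) u i t| <= 2 * K * th ^+ N.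
  have [tI|] := boolP (a <= t <= b); last by exists 0.
  by have [l hl] := geometric_cvg th01 K0 (fun i => hu i t tI); exists l.
have [y hy] := choice ex; exists y; split; last by move=> N t /hy[_].
split.
  apply: (@measurable_fun_cvg _ _ _ _ (fun N t => \sum_(i < N) u i t)).
    by move=> N; apply: measurable_sum => i; case: (bu i).
  by move=> t; rewrite /= in_itv /= => /hy[].
exists (2 * K) => t /hy[_ /(_ 0%N)].
by rewrite big_ord0 subr0 expr0 mulr1.
Qed.

Lemma ReN (z : C R) : cRe (- z) = - cRe z.
Proof. by case: z. Qed.

Lemma ImN (z : C R) : cIm (- z) = - cIm z.
Proof. by case: z. Qed.

Lemma Re_sum (J : Type) (r : seq J) (F : J -> C R) :
  cRe (\sum_(i <- r) F i) = \sum_(i <- r) cRe (F i).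
Proof. by elim: r => [|i r IH]; rewrite ?big_nil // !big_cons ReD IH. Qed.

Lemma Im_sum (J : Type) (r : seq J) (F : J -> C R) :
  cIm (\sum_(i <- r) F i) = \sum_(i <- r) cIm (F i).
Proof. by elim: r => [|i r IH]; rewrite ?big_nil // !big_cons ImD IH. Qed.

Lemma bmc_series (u : nat -> R -> C R) (K th : R) : 0 < th <= 2^-1 -> 0 <= K ->
  (forall i, bmc a b (u i)) ->
  (forall i t, a <= t <= b -> cabs (u i t) <= K * th ^+ i) ->
  exists y, bmc a b y /\
    forall N t, a <= t <= b -> cabs (y t - \sum_(i < N) u i t) <= 4 * K * th ^+ N.
Proof.
move=> th01 K0 bu hu.
have [||yr [br hr]] := @bmr_series (fun i t => cRe (u i t)) K th th01 K0.
- by move=> i; case: (bu i).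
- by move=> i t tI; apply: le_trans (hu i t tI); case: (ReIm_le_cabs (u i t)).
have [||yi [bi hi]] := @bmr_series (fun i t => cIm (u i t)) K th th01 K0.
- by move=> i; case: (bu i).
- by move=> i t tI; apply: le_trans (hu i t tI); case: (ReIm_le_cabs (u i t)).
exists (fun t => Complex (yr t) (yi t)); split=> // N t tI.
apply: le_trans (cabs_le_ReIm _) _.
rewrite ReD ImD ReN ImN Re_sum Im_sum.
have -> : 4 * K * th ^+ N = 2 * K * th ^+ N + 2 * K * th ^+ N by ring.
by apply: lerD; [exact: hr|exact: hi].
Qed.

Lemma inW_sum k (J : Type) (r : seq J) (F : J -> R -> C R) :
  (forall i, inW a b k (F i)) -> inW a b k (fun t => \sum_(i <- r) F i t).
Proof.
move=> hF; elim: r => [|i r IH].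
  by under eq_fun do rewrite big_nil; exact: inW_cst.
by have := inW_lin ab 1 (hF i) IH; under eq_fun do rewrite mul1r -(big_cons _ _ i r xpredT).
Qed.

Lemma linf0 : linf a b (fun=> 0 : C R) = 0.
Proof.
apply/eqP; rewrite eq_le linf_ge0 andbT; apply: linf_le => //.
by apply: aeI_all => t _; rewrite cabs0.
Qed.

Lemma prs0 : prs a b 0 (fun=> 0) (fun=> 0).
Proof.
split; first exact: bmc_cst.
apply: aeI_all => t /andP[_ tb]; rewrite add0r.
have := cprimZ ab 0 (bmc_cst a b 0) tb.
by rewrite !mul0r => ->.
Qed.

Lemma sobnorm_cst0 k : sobnorm a b k (fun=> 0 : C R) = 0.
Proof.
elim: k => [|k IH]; last by rewrite (sobnormS ab prs0 (inW_cst ab k 0)) IH linf0 addr0.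
by rewrite sobnorm0E ?linf0 //; apply: bmc_W0; exact: bmc_cst.
Qed.

Lemma sobnorm_sum k (J : Type) (r : seq J) (F : J -> R -> C R) :
  (forall i, inW a b k (F i)) ->
  sobnorm a b k (fun t => \sum_(i <- r) F i t) <= \sum_(i <- r) sobnorm a b k (F i).
Proof.
move=> hF; elim: r => [|i r IH].
  by under eq_fun do rewrite big_nil; rewrite big_nil sobnorm_cst0.
rewrite big_cons; have := sobnorm_lin ab 1 (hF i) (inW_sum r hF).
under eq_fun do rewrite mul1r -(big_cons _ _ i r xpredT).
by rewrite cabs1 mul1r => /le_trans; apply; rewrite lerD2l.
Qed.

Lemma prs_sum (J : Type) (r : seq J) (c : J -> C R) (z y : J -> R -> C R) :
  (forall i, prs a b (c i) (z i) (y i)) ->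
  prs a b (\sum_(i <- r) c i) (fun t => \sum_(i <- r) z i t) (fun t => \sum_(i <- r) y i t).
Proof.
move=> h; elim: r => [|i r IH].
  have E (F : J -> R -> C R) : (fun t => \sum_(i <- [::]) F i t) = fun=> 0.
    by apply/funext => t; rewrite big_nil.
  by rewrite big_nil !E; exact: prs0.
have := prs_lin ab 1 (h i) IH; rewrite mul1r big_cons.
under [X in prs _ _ _ X _ -> _]eq_fun do rewrite mul1r -(big_cons _ _ i r xpredT).
by under [X in prs _ _ _ _ X -> _]eq_fun do rewrite mul1r -(big_cons _ _ i r xpredT).
Qed.

Lemma prsB (c c' : C R) z z' y y' : prs a b c z y -> prs a b c' z' y' ->
  prs a b (c - c') (fun t => z t - z' t) (fun t => y t - y' t).
Proof.
move=> h h'; have := prs_lin ab (- 1) h' h.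
rewrite mulN1r addrC; under [X in prs _ _ _ X _ -> _]eq_fun do rewrite mulN1r addrC.
by under [X in prs _ _ _ _ X -> _]eq_fun do rewrite mulN1r addrC.
Qed.

Lemma inWB k y y' : inW a b k y -> inW a b k y' -> inW a b k (fun t => y t - y' t).
Proof.
by move=> h h'; have := inW_lin ab (- 1) h' h; under eq_fun do rewrite mulN1r addrC.
Qed.

(** Completeness for geometrically dominated series, with a rate whose constant does not depend on
    the series. At order k + 1 the initial values and the derivatives are summed separately, and the
    limit is integrated from them. *)
Lemma sobnorm_complete k : exists2 K : R, 0 <= K &
  forall (u : nat -> R -> C R) (th : R), 0 < th <= 2^-1 ->
    (forall i, inW a b k (u i) /\ sobnorm a b k (u i) <= th ^+ i) ->
    exists2 y, inW a b k y &
      forall N, sobnorm a b k (fun t => y t - \sum_(i < N) u i t) <= K * th ^+ N.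
Proof.
elim: k => [|k [K K0 IH]].
  (* 8 = 4 * 2: clipping leaves |h i| <= 2 th^i, and [bmc_series] contributes 4. *)
  exists 8 => // u th th01 hu; have /andP[th0 _] := th01.
  have ex i : exists h, [/\ bmc a b h, u i =ae h & forall t, cabs (h t) <= 2 * th ^+ i].
    have [/inW0P hi ui] := hu i; rewrite sobnorm0E // in ui.
    have [g bg ug] := hi; have [[m1 _] [m2 _]] := bg.
    have ti : 0 <= th ^+ i by rewrite exprn_ge0 // ltW.
    have [|h [bh gh hM]] := clip m1 m2 ti.
      apply: aeI_sub2 ug (linf_ub hi) => t _ <- h; exact: le_trans h ui.
    exists h; split=> //; first exact: ae_trans ug gh.
    move=> t; apply: le_trans (cabs_le_ReIm _) _; rewrite mulr_natl mulr2n.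
    by have [? ?] := hM t; exact: lerD.
  have [h hh] := choice ex.
  have [||y [By hy]] := @bmc_series h 2 th th01 (ler0n _ _).
  - by move=> i; case: (hh i).
  - by move=> i t _; case: (hh i).
  exists y => [|N]; first exact/inW0P/bmc_W0.
  have E : (fun t => y t - \sum_(i < N) h i t) =ae (fun t => y t - \sum_(i < N) u i t).
    have H : aeI a b (fun t => forall i, u i t = h i t).
      by apply: aeI_nat => i; case: (hh i).
    by apply: aeI_sub H => t _ H; congr (_ - _); apply: eq_bigr => i _.
  have bd : bmc a b (fun t => y t - \sum_(i < N) h i t).
    by apply: bmcB => //; apply: bmc_sum => i; case: (hh i).
  rewrite (sobnorm_ae ab E); last exact/inW0P/bmc_W0.
  rewrite (sobnorm0E ab); last exact: bmc_W0.
  have e8 : 8 = 4 * 2 :> R by rewrite -natrM.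
  rewrite e8; apply: linf_le; last by apply: aeI_all => t; exact: hy.
  by rewrite !mulr_ge0 // exprn_ge0 // ltW.
(* The factor with which [cabs_init_le] bounds the initial values by th^i. *)
pose L : R := 1 + 4 * (b - a).
have L0 : 0 <= L by rewrite addr_ge0 // mulr_ge0 // subr_ge0 ltW.
exists (4 * L + 4 * (b - a) * K + K).
  by rewrite !addr_ge0 ?mulr_ge0 // subr_ge0 ltW.
move=> u th th01 hu; have /andP[th0 _] := th01.
have ex i : exists cz : C R * (R -> C R), [/\ prs a b cz.1 cz.2 (u i),
    inW a b k cz.2, sobnorm a b k cz.2 <= th ^+ i & cabs cz.1 <= L * th ^+ i].
  have [hi ui] := hu i; have [c [z [pz hz]]] := inWS_elim hi.
  rewrite (sobnormS ab pz hz) in ui; exists (c, z); split=> //=.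
    by apply: le_trans ui; rewrite lerDr linf_ge0.
  apply: le_trans (cabs_init_le ab pz) _; rewrite /L [leRHS]mulrDl mul1r; apply: lerD.
    by apply: le_trans ui; rewrite lerDl sobnorm_ge0.
  apply: ler_wpM2l; first by rewrite mulr_ge0 // subr_ge0 ltW.
  apply: le_trans (linf_le_sobnorm ab hz) _.
  by apply: le_trans ui; rewrite lerDr linf_ge0.
have [cz hcz] := choice ex.
have [|z hz Nz] := IH (fun i => (cz i).2) th th01; first by move=> i; case: (hcz i).
have [w bw zw] := inW_W0 ab hz.
(* The initial values are summed as a series of constant functions, whose limit is read at a. *)
have [||g [_ hg]] := @bmc_series (fun i _ => (cz i).1) L th th01 L0.
- by move=> i; exact: bmc_cst.
- by move=> i t _; case: (hcz i).
pose c := g a.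
have pw : prs a b c w (fun t => c + cprim a w t) by split=> //; exact: ae_refl.
have hw := inW_ae zw hz.
exists (fun t => c + cprim a w t); first exact: inWS pw hw.
move=> N.
have ps := @prs_sum _ (index_enum 'I_N) (fun i => (cz i).1) (fun i => (cz i).2) (fun i => u i)
  (fun i => let: And4 h _ _ _ := hcz i in h).
have pd := prsB pw ps.
have hzs : inW a b k (fun t => \sum_(i < N) (cz i).2 t).
  by apply: inW_sum => i; case: (hcz i).
have hd := inWB hw hzs.
have dE : (fun t => z t - \sum_(i < N) (cz i).2 t) =ae
          (fun t => w t - \sum_(i < N) (cz i).2 t).
  by apply: aeI_sub zw => t _ ->.
have nd := Nz N; rewrite -(sobnorm_ae ab dE (inWB hz hzs)) in nd.
rewrite (sobnormS ab pd hd) mulrDl; apply: lerD => //.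
apply: le_trans (linf_prs_le ab pd) _; rewrite [leRHS]mulrDl; apply: lerD.
  by apply: hg; rewrite lexx ltW.
rewrite -[leRHS]mulrA; apply: ler_wpM2l; first by rewrite mulr_ge0 // subr_ge0 ltW.
exact: le_trans (linf_le_sobnorm ab hd) nd.
Qed.

End Completeness.

(** * Volterra equations *)

Lemma bmc_family_bound (R : realType) (a b : R) (J : finType) (u : J -> R -> C R) :
  (forall i, bmc a b (u i)) ->
  exists2 M : R, 0 <= M & forall i t, a <= t <= b -> cabs (u i t) <= M.
Proof.
move=> bu.
have ex i : exists M : R, 0 <= M /\ forall t, a <= t <= b -> cabs (u i t) <= M.
  by have [M M0 h] := bmc_bound (bu i); exists M.
have [M hM] := choice ex; exists (\sum_i M i).
  by apply: sumr_ge0 => i _; case: (hM i).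
move=> i t tI; rewrite (bigD1 i) //= -[leLHS]addr0.
have [_ h] := hM i; apply: lerD; first exact: h.
by apply: sumr_ge0 => j _; case: (hM j).
Qed.

Section Volterra.
Variables (R : realType) (a b : R) (m : nat).
Hypothesis ab : a < b.
Notation "f =ae g" := (aeI a b (fun t => f t = g t)) (at level 70).
Notation C := (C R).
Variables (A : 'I_m -> 'I_m -> R -> C) (L l : R).
Hypothesis bA : forall i j, bmc a b (A i j).
Hypothesis AL : forall i j t, a <= t <= b -> cabs (A i j t) <= L.
Hypothesis L0 : 0 <= L.
Hypothesis l0 : 0 < l.
Hypothesis lE : l = 4 * m%:R * L.
Variables (F : 'I_m -> R -> C) (q : 'I_m -> C).
Hypothesis bF : forall i, bmc a b (F i).

(** Its fixed points are the solutions of u' + A u = F, u(a) = q, in integral form. *)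
Definition volterra (u : 'I_m -> R -> C) i x :=
  q i + cprim a (fun t => F i t - \sum_j A i j t * u j t) x.

Lemma le0_geometric (x c : R) : (forall N, x <= c * 2^-1 ^+ N) -> x <= 0.
Proof.
move=> h; have c0 : 0 <= `|c| + 1 by exact: addr_ge0.
apply/ler_addgt0Pr => e e0; rewrite add0r.
have N := truncnS_gt ((`|c| + 1) / e); set k := (Num.truncn _).+1 in N.
have k2 : k%:R <= (2 : R) ^+ k by rewrite -natrX ler_nat; exact/ltnW/ltn_expl.
apply: le_trans (h k) _; apply: (@le_trans _ _ ((`|c| + 1) * 2^-1 ^+ k)).
  by rewrite ler_wpM2r ?exprn_ge0 // (le_trans (ler_norm c)) // lerDl.
rewrite exprVn ler_pdivrMr ?exprn_gt0 // mulrC -ler_pdivrMr //.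
exact: le_trans (ltW N) k2.
Qed.

Lemma expR_ge1 (t : R) : a <= t -> 1 <= expR (l * (t - a)).
Proof.
by move=> at_; rewrite -expR0 ler_expR mulr_ge0 ?(ltW l0) // subr_ge0.
Qed.

(* In the norm sup |u(t)| exp(- l (t - a)) with l = 4 m L, the Volterra operator
   is a contraction of ratio 1/2 on the whole interval; this replaces both the
   factorials of Picard's iteration and Gronwall's lemma. *)
Lemma volterra_half (u : 'I_m -> R -> C) (M x : R) i : 0 <= M -> a <= x <= b ->
  (forall j, bmc a b (u j)) ->
  (forall j t, a <= t <= x -> cabs (u j t) <= M * expR (l * (t - a))) ->
  cabs (cprim a (fun t => \sum_j A i j t * u j t) x) <= M / 2 * expR (l * (x - a)).
Proof.
move=> M0 xI bu hu; have /andP[ax xb] := xI.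
have -> : M / 2 = 2 * (m%:R * (L * M)) / l.
  have : 4 * m%:R * L != 0 by rewrite -lE gt_eqF.
  rewrite lE !mulf_eq0 !negb_or => /andP[/andP[_ m0] L1]; field.
  by rewrite L1 m0.
apply: (cprim_exp_bound ab l0) => //.
- by rewrite !mulr_ge0.
- by apply: bmc_sum => j; exact: bmcM.
move=> t /andP[at_ tx]; apply: le_trans (cabs_sum _ _) _.
have -> : m%:R * (L * M) * expR (l * (t - a)) =
    \sum_(j < m) L * (M * expR (l * (t - a))).
  by rewrite sumr_const card_ord -[in RHS]mulr_natl; ring.
apply: ler_sum => j _; rewrite cabsM ler_pM ?cabs_ge0 //.
  by apply: AL; rewrite at_ (le_trans tx).
by apply: hu; rewrite at_.
Qed.

Lemma bmc_volterra u i : (forall j, bmc a b (u j)) -> bmc a b (volterra u i).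
Proof.
move=> bu; apply: (bmc_affine ab); apply: bmcB => //.
by apply: bmc_sum => j; exact: bmcM.
Qed.

Lemma volterra_contract u v (M x : R) i : 0 <= M -> a <= x <= b ->
  (forall j, bmc a b (u j)) -> (forall j, bmc a b (v j)) ->
  (forall j t, a <= t <= x -> cabs (u j t - v j t) <= M * expR (l * (t - a))) ->
  cabs (volterra u i x - volterra v i x) <= M / 2 * expR (l * (x - a)).
Proof.
move=> M0 xI bu bv huv; have /andP[ax xb] := xI.
have bs w : (forall j, bmc a b (w j)) ->
    bmc a b (fun t => F i t - \sum_j A i j t * w j t).
  by move=> bw; apply: bmcB => //; apply: bmc_sum => j; exact: bmcM.
rewrite /volterra opprD addrACA subrr add0r -(cprimB ab (bs _ bu) (bs _ bv) xb).
have -> : (fun t => F i t - \sum_j A i j t * u j t -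
    (F i t - \sum_j A i j t * v j t)) =
    (fun t => \sum_j A i j t * (v j t - u j t)).
  apply/funext => t; under [RHS]eq_bigr do rewrite mulrBr.
  by rewrite big_split /= sumrN; ring.
apply: (@volterra_half (fun j t => v j t - u j t)) => //.
  by move=> j; exact: bmcB.
by move=> j t tx; rewrite -cabsN opprB; exact: huv.
Qed.

(** Successive iterates from 0 differ by O(2^-N) in the weighted norm, so they converge to some Y.
    It is a fixed point because Y - y_(N+1) and V(y_N) - V(Y) are both O(2^-N), V being the Volterra
    operator. *)
Lemma volterra_solvable : exists Y : 'I_m -> R -> C,
  (forall i, bmc a b (Y i)) /\
  forall i x, a <= x <= b -> Y i x = volterra Y i x.
Proof.
pose y N := iter N volterra (fun _ _ => 0).
have yS N : y N.+1 = volterra (y N) by [].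
have bY N j : bmc a b (y N j).
  elim: N j => [|N IH] j; first exact: bmc_cst.
  by rewrite yS; exact: bmc_volterra.
have [M M0 hM] := bmc_family_bound (fun i => bmcB (bY 1%N i) (bY 0%N i)).
have D N i t : a <= t <= b ->
    cabs (y N.+1 i t - y N i t) <= M * 2^-1 ^+ N * expR (l * (t - a)).
  elim: N i t => [|N IH] i t tI; have /andP[at_ tb] := tI.
    rewrite expr0 mulr1; apply: le_trans (hM i t tI) _.
    by rewrite ler_peMr // expR_ge1.
  rewrite exprSr mulrA.
  apply: (@volterra_contract (y N.+1) (y N))  => //.
    by rewrite mulr_ge0 // exprn_ge0.
  move=> j s /andP[as_ st]; apply: IH; by rewrite as_ (le_trans st).
(* The largest weight on [a, b], which turns weighted bounds into uniform ones. *)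
pose W := expR (l * (b - a)).
have W0 : 0 <= W by exact: expR_ge0.
have eW t : t <= b -> expR (l * (t - a)) <= W.
  by move=> tb; rewrite ler_expR ler_wpM2l ?(ltW l0) // lerB.
have MW0 : 0 <= M * W by rewrite mulr_ge0.
have half : 0 < (2^-1 : R) <= 2^-1 by rewrite lexx invr_gt0 ltr0n.
have ex i : exists Yi, bmc a b Yi /\ forall N t, a <= t <= b ->
    cabs (Yi t - y N i t) <= 4 * (M * W) * 2^-1 ^+ N.
  have [||Yi [bYi hYi]] :=
      @bmc_series R a b (fun N t => y N.+1 i t - y N i t) (M * W) 2^-1 half MW0.
  - by move=> N; exact: bmcB.
  - move=> N t tI; have /andP[_ tb] := tI.
    apply: le_trans (D N i t tI) _; rewrite mulrAC ler_wpM2r ?exprn_ge0 //.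
    by rewrite ler_wpM2l // eW.
  exists Yi; split=> // N t tI; have := hYi N t tI.
  rewrite -(big_mkord xpredT (fun N => y N.+1 i t - y N i t)).
  by rewrite (telescope_sumr (fun N => y N i t)) // subr0.
have [Y hY] := choice ex.
have bYY j : bmc a b (Y j) by case: (hY j).
exists Y; split=> // i x xI; have /andP[ax xb] := xI.
apply/eqP; rewrite -subr_eq0; apply/eqP; apply: cabs_eq0; apply/eqP.
rewrite eq_le cabs_ge0 andbT.
apply: (@le0_geometric _ (4 * (M * W) * (1 + W))) => N.
have -> : Y i x - volterra Y i x =
  (Y i x - y N.+1 i x) + (volterra (y N) i x - volterra Y i x) by rewrite yS addrA subrK.
apply: le_trans (cabsD _ _) _.
have -> : 4 * (M * W) * (1 + W) * 2^-1 ^+ N =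
  4 * (M * W) * 2^-1 ^+ N + 4 * (M * W) * 2^-1 ^+ N * W by ring.
have K0 : 0 <= 4 * (M * W) * 2^-1 ^+ N by rewrite !mulr_ge0 // exprn_ge0.
apply: lerD.
  have [_ h] := hY i; apply: le_trans (h N.+1 x xI) _.
  rewrite exprS mulrCA ler_piMl // invf_le1 ?ler1n //.
apply: (@le_trans _ _ (4 * (M * W) * 2^-1 ^+ N / 2 * expR (l * (x - a)))).
  apply: volterra_contract => // j t /andP[at_ tx].
  have tI : a <= t <= b by rewrite at_ (le_trans tx).
  have [_ h] := hY j; rewrite -cabsN opprB; apply: le_trans (h N t tI) _.
  by rewrite ler_peMr // expR_ge1.
apply: ler_pM => //; first by rewrite divr_ge0.
- by rewrite ler_piMr // invf_le1 // ler1n.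
- exact: eW.
Qed.

(** A bound |Y(t)| <= X exp(l (t - a)) improves itself to the same bound with al + X / 2 in place of
    X. Iterated from a crude bound, it tends to the fixed value X = 2 al. *)
Lemma volterra_bound (Y : 'I_m -> R -> C) (al : R) : 0 <= al ->
  (forall i, bmc a b (Y i)) ->
  (forall i x, a <= x <= b -> Y i x = volterra Y i x) ->
  (forall i x, a <= x <= b -> cabs (q i + cprim a (F i) x) <= al) ->
  forall i x, a <= x <= b -> cabs (Y i x) <= 2 * expR (l * (b - a)) * al.
Proof.
move=> al0 bY YE hal.
have [M M0 hM] := bmc_family_bound bY.
have P0 N : 0 <= M * 2^-1 ^+ N by rewrite mulr_ge0 // exprn_ge0.
have H N i t : a <= t <= b ->
    cabs (Y i t) <= (2 * al + M * 2^-1 ^+ N) * expR (l * (t - a)).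
  elim: N i t => [|N IH] i t tI; have /andP[at_ tb] := tI.
    rewrite expr0 mulr1; apply: le_trans (hM i t tI) _.
    apply: (@le_trans _ _ (2 * al + M)); first by rewrite lerDr mulr_ge0.
    by rewrite ler_peMr ?expR_ge1 // addr_ge0 // mulr_ge0.
  have bs : bmc a b (fun s => \sum_j A i j s * Y j s).
    by apply: bmc_sum => j; exact: bmcM.
  rewrite YE // /volterra (cprimB ab (bF i) bs tb) addrA.
  apply: le_trans (cabsB _ _) _.
  have -> : (2 * al + M * 2^-1 ^+ N.+1) * expR (l * (t - a)) =
    al * expR (l * (t - a)) +
      (2 * al + M * 2^-1 ^+ N) / 2 * expR (l * (t - a)) by rewrite exprSr; field.
  apply: lerD.
    by apply: le_trans (hal i t tI) _; rewrite ler_peMr // expR_ge1.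
  apply: volterra_half => //; first by rewrite addr_ge0 // mulr_ge0.
  by move=> j s /andP[as_ st]; apply: IH; rewrite as_ (le_trans st).
move=> i x xI; have /andP[ax xb] := xI; rewrite -subr_le0.
apply: (@le0_geometric _ (M * expR (l * (b - a)))) => N.
rewrite lerBlDr; apply: le_trans (H N i x xI) _.
apply: (@le_trans _ _ ((2 * al + M * 2^-1 ^+ N) * expR (l * (b - a)))).
  apply: ler_wpM2l; first by rewrite addr_ge0 // mulr_ge0.
  by rewrite ler_expR ler_wpM2l ?(ltW l0) // lerB.
by rewrite le_eqVlt; apply/orP; left; apply/eqP; ring.
Qed.

End Volterra.

(** * Linear systems *)

Section VectorFunctions.
Variables (R : realType) (a b : R) (m : nat).
Hypothesis ab : a < b.
Notation C := (C R).
Notation "f =ae g" := (aeI a b (fun t => f t = g t)) (at level 70).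
Implicit Types (Y Z F : R -> 'cV[C]_m) (A : R -> 'M[C]_m) (q : 'cV[C]_m).

Lemma bmc_cprim_ae (f g : R -> C) x : bmc a b f -> bmc a b g -> x <= b ->
  f =ae g -> cprim a f x = cprim a g x.
Proof. by move=> [[? _] [? _]] [[? _] [? _]]; exact: cprim_ae. Qed.

Lemma aev_comp Y Z : (forall i, (fun t => Y t i 0) =ae (fun t => Z t i 0)) -> Y =ae Z.
Proof. by move=> h; apply: aeI_sub (aeI_ord h) => t _ H; apply/colP. Qed.

Lemma comp_aev Y Z i : Y =ae Z -> (fun t => Y t i 0) =ae (fun t => Z t i 0).
Proof. by apply: aeI_sub => t _ ->. Qed.

Lemma inWv_ae k Y Z : Y =ae Z -> inWv a b k Y -> inWv a b k Z.
Proof. by move=> e h i; exact: inW_ae (comp_aev i e) (h i). Qed.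

Lemma sobnormv_ae k Y Z : Y =ae Z -> inWv a b k Y ->
  sobnormv a b k Z = sobnormv a b k Y.
Proof.
by move=> e h; apply: eq_bigr => i _; exact: (sobnorm_ae ab (comp_aev i e)).
Qed.

Lemma sobnormv_ge0 k Y : 0 <= sobnormv a b k Y.
Proof. by apply: sumr_ge0 => i _; exact: sobnorm_ge0. Qed.

Lemma sobnorm_le_sobnormv k Y i :
  sobnorm a b k (fun t => Y t i 0) <= sobnormv a b k Y.
Proof.
rewrite /sobnormv (bigD1 i) //= lerDl; apply: sumr_ge0 => j _; exact: sobnorm_ge0.
Qed.

Lemma linE (l : C) Y Z i : (fun t => (l *: Y t + Z t) i 0) =
  (fun t => l * Y t i 0 + Z t i 0).
Proof. by apply/funext => t; rewrite !mxE. Qed.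

Lemma inWv_lin k (l : C) Y Z : inWv a b k Y -> inWv a b k Z ->
  inWv a b k (fun t => l *: Y t + Z t).
Proof. by move=> h h' i; rewrite linE; exact: inW_lin. Qed.

Lemma sobnormv_lin k (l : C) Y Z : inWv a b k Y -> inWv a b k Z ->
  sobnormv a b k (fun t => l *: Y t + Z t) <=
  cabs l * sobnormv a b k Y + sobnormv a b k Z.
Proof.
move=> h h'; rewrite /sobnormv mulr_sumr -big_split /=; apply: ler_sum => i _.
rewrite linE; exact: sobnorm_lin.
Qed.

Lemma subE Y Z : (fun t => Y t - Z t) = (fun t => - 1 *: Z t + Y t).
Proof. by apply/funext => t; rewrite scaleN1r addrC. Qed.

Lemma inWvB k Y Z : inWv a b k Y -> inWv a b k Z -> inWv a b k (fun t => Y t - Z t).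
Proof. by move=> h h'; rewrite subE; exact: inWv_lin. Qed.

Lemma inWvD k Y Z : inWv a b k Y -> inWv a b k Z -> inWv a b k (fun t => Y t + Z t).
Proof.
move=> h h'; have := inWv_lin 1 h h'; congr inWv.
by apply/funext => t; rewrite scale1r.
Qed.

Lemma sobnormvD k Y Z : inWv a b k Y -> inWv a b k Z ->
  sobnormv a b k (fun t => Y t + Z t) <= sobnormv a b k Y + sobnormv a b k Z.
Proof.
move=> h h'; have -> : (fun t => Y t + Z t) = (fun t => 1 *: Y t + Z t).
  by apply/funext => t; rewrite scale1r.
by apply: le_trans (sobnormv_lin 1 h h') _; rewrite cabs1 mul1r.
Qed.

Lemma sobnormvB k Y Z : inWv a b k Y -> inWv a b k Z ->
  sobnormv a b k (fun t => Y t - Z t) <= sobnormv a b k Y + sobnormv a b k Z.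
Proof.
move=> h h'; rewrite subE addrC; apply: le_trans (sobnormv_lin _ h' h) _.
by rewrite cabsN cabs1 mul1r.
Qed.

Lemma inWv_cst k q : inWv a b k (fun=> q).
Proof. by move=> i; exact: inW_cst. Qed.

Lemma sobnormv_cst0 k : sobnormv a b k (fun=> 0 : 'cV[C]_m) = 0.
Proof.
by apply: big1 => i _; rewrite -(sobnorm_cst0 ab k); congr sobnorm; apply/funext => t; rewrite mxE.
Qed.

Lemma inWvZ k (l : C) Y : inWv a b k Y -> inWv a b k (fun t => l *: Y t).
Proof.
move=> h; have := inWv_lin l h (inWv_cst k 0); congr inWv.
by apply/funext => t; rewrite addr0.
Qed.

Lemma sobnormvZ k (l : C) Y : inWv a b k Y ->
  sobnormv a b k (fun t => l *: Y t) <= cabs l * sobnormv a b k Y.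
Proof.
move=> h; have -> : (fun t => l *: Y t) = (fun t => l *: Y t + 0).
  by apply/funext => t; rewrite addr0.
by apply: le_trans (sobnormv_lin l h (inWv_cst k 0)) _; rewrite sobnormv_cst0 addr0.
Qed.

Lemma inWv_sum k (J : Type) (r : seq J) (f : J -> R -> 'cV[C]_m) :
  (forall j, inWv a b k (f j)) -> inWv a b k (fun t => \sum_(j <- r) f j t).
Proof.
move=> h i; have := inW_sum ab r (fun j => h j i); congr inW.
by apply/funext => t; rewrite summxE.
Qed.

Lemma inWv_mono k Y : inWv a b k.+1 Y -> inWv a b k Y.
Proof. by move=> h i; exact: inW_mono. Qed.

Lemma sobnormv_mono k Y : inWv a b k.+1 Y ->
  sobnormv a b k Y <= sobnormv a b k.+1 Y.
Proof. by move=> h; apply: ler_sum => i _; exact: sobnorm_mono. Qed.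

Lemma inWm_mono k A : inWm a b k.+1 A -> inWm a b k A.
Proof. by move=> h i j; exact: inW_mono. Qed.

Lemma inWmB k A A' : inWm a b k A -> inWm a b k A' ->
  inWm a b k (fun t => A t - A' t).
Proof.
move=> h h' i j; have := inWB ab (h i j) (h' i j); congr inW.
by apply/funext => t; rewrite !mxE.
Qed.

Definition vprs q Z Y :=
  forall i, prs a b (q i 0) (fun t => Z t i 0) (fun t => Y t i 0).

Definition linfv Y := \sum_i linf a b (fun t => Y t i 0).

Lemma inWvS_elim k Y : inWv a b k.+1 Y -> exists q Z, vprs q Z Y /\ inWv a b k Z.
Proof.
move=> h.
have ex i : exists cz : C * (R -> C),
    prs a b cz.1 cz.2 (fun t => Y t i 0) /\ inW a b k cz.2.
  by have [c [z hz]] := inWS_elim (h i); exists (c, z).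
have [cz hcz] := choice ex.
exists (\col_i (cz i).1), (fun t => \col_i (cz i).2 t).
have E i : (fun t => (\col_i (cz i).2 t) i 0) = (cz i).2.
  by apply/funext => t; rewrite mxE.
by split=> i; rewrite E ?mxE; case: (hcz i).
Qed.

Lemma inWvS k q Z Y : vprs q Z Y -> inWv a b k Z -> inWv a b k.+1 Y.
Proof. by move=> p h i; exact: inWS (p i) (h i). Qed.

Lemma sobnormvS k q Z Y : vprs q Z Y -> inWv a b k Z ->
  sobnormv a b k.+1 Y = linfv Y + sobnormv a b k Z.
Proof.
move=> p h; rewrite /sobnormv /linfv -big_split; apply: eq_bigr => i _.
exact: sobnormS (p i) (h i).
Qed.

Lemma sobnormv0E Y : inWv a b 0 Y -> sobnormv a b 0 Y = linfv Y.
Proof. by move=> h; apply: eq_bigr => i _; apply: sobnorm0E => //; exact/inW0P. Qed.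

Lemma linfv_le_sobnormv k Y : inWv a b k Y -> linfv Y <= sobnormv a b k Y.
Proof. by move=> h; apply: ler_sum => i _; exact: linf_le_sobnorm. Qed.

Lemma vprs_inj q q' Z Z' Y Y' : Y =ae Y' -> vprs q Z Y -> vprs q' Z' Y' ->
  q = q' /\ Z =ae Z'.
Proof.
move=> e p p'; have H i := prs_inj ab (comp_aev i e) (p i) (p' i).
by split; [apply/colP => i; case: (H i)|apply: aev_comp => i; case: (H i)].
Qed.

Lemma vprs_lin (l : C) q q' Z Z' Y Y' : vprs q Z Y -> vprs q' Z' Y' ->
  vprs (l *: q + q') (fun t => l *: Z t + Z' t) (fun t => l *: Y t + Y' t).
Proof. by move=> p p' i; rewrite !linE !mxE; exact: prs_lin. Qed.

Lemma vprs_inW0 q Z Y : vprs q Z Y -> inWv a b 0 Z.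
Proof. by move=> p i; apply/inW0P/bmc_W0; case: (p i). Qed.

Lemma vderiv_ae q Z Y : vprs q Z Y -> vderiv a b Y =ae Z.
Proof.
move=> p; apply: aev_comp => i; apply: aeI_sub (dchain1 ab (p i)) => t _ <-.
by rewrite /vderiv mxE.
Qed.

(** Here [Lop] is freed from the derivative chosen by [dchain]. *)
Lemma Lop_ae A q Z Y : vprs q Z Y -> Lop a b A Y =ae (fun t => Z t + A t *m Y t).
Proof. by move=> /vderiv_ae; apply: aeI_sub => t _; rewrite /Lop => ->. Qed.

Lemma mulmxE A Y i : (fun t => (A t *m Y t) i 0) =
  (fun t => \sum_j A t i j * Y t j 0).
Proof. by apply/funext => t; rewrite mxE. Qed.

Lemma inWv_mulmx k A Y : inWm a b k A -> inWv a b k Y ->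
  inWv a b k (fun t => A t *m Y t).
Proof.
move=> hA hY i; rewrite mulmxE; apply: inW_sum => // j.
by case: (sobnorm_mul ab (hA i j) (hY j)).
Qed.

Lemma sobnormv_mulmx k A Y : inWm a b k A -> inWv a b k Y ->
  sobnormv a b k (fun t => A t *m Y t) <=
  2 ^+ k * sobnormm a b k A * sobnormv a b k Y.
Proof.
move=> hA hY; rewrite /sobnormm -mulrA mulr_suml mulr_sumr; apply: ler_sum => i _.
rewrite mulr_suml mulr_sumr mulmxE.
have h j := sobnorm_mul ab (hA i j) (hY j).
apply: le_trans (sobnorm_sum ab _ (fun j => (h j).1)) _; apply: ler_sum => j _.
apply: le_trans (h j).2 _; rewrite mulrA ler_wpM2l ?sobnorm_le_sobnormv //.
by rewrite mulr_ge0 ?exprn_ge0 ?sobnorm_ge0.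
Qed.

Lemma sobnormm_ge0 k A : 0 <= sobnormm a b k A.
Proof. by apply: sumr_ge0 => i _; apply: sumr_ge0 => j _; exact: sobnorm_ge0. Qed.

Lemma inWv_Lop k A Y : inWm a b k A -> inWv a b k.+1 Y ->
  inWv a b k (Lop a b A Y).
Proof.
move=> hA hY; have [q [Z [p hZ]]] := inWvS_elim hY.
apply: inWv_ae (aeI_sub _ (Lop_ae A p)) _; first by move=> t _ ->.
by apply: inWvD => //; apply: inWv_mulmx => //; exact: inWv_mono.
Qed.

Lemma sobnormv_Lop k A Y : inWm a b k A -> inWv a b k.+1 Y ->
  sobnormv a b k (Lop a b A Y) <=
  (1 + 2 ^+ k * sobnormm a b k A) * sobnormv a b k.+1 Y.
Proof.
move=> hA hY; have [q [Z [p hZ]]] := inWvS_elim hY.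
have hAY := inWv_mulmx hA (inWv_mono hY).
rewrite -(sobnormv_ae (Lop_ae A p) (inWv_Lop hA hY)).
apply: le_trans (sobnormvD hZ hAY) _; rewrite mulrDl mul1r; apply: lerD.
  rewrite (sobnormvS p hZ) lerDr; apply: sumr_ge0 => i _; exact: linf_ge0.
apply: le_trans (sobnormv_mulmx hA (inWv_mono hY)) _.
by rewrite ler_wpM2l ?sobnormv_mono // mulr_ge0 ?exprn_ge0 ?sobnormm_ge0.
Qed.

Lemma Lop_lin A (l : C) Y Y' : inWv a b 1 Y -> inWv a b 1 Y' ->
  Lop a b A (fun t => l *: Y t + Y' t) =ae
  (fun t => l *: Lop a b A Y t + Lop a b A Y' t).
Proof.
move=> /inWvS_elim[q [Z [p _]]] /inWvS_elim[q' [Z' [p' _]]].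
apply: aeI_sub3 (Lop_ae A p) (Lop_ae A p') (Lop_ae A (vprs_lin l p p')).
move=> t _ -> -> ->; rewrite mulmxDr -scalemxAr scalerDr; exact: addrACA.
Qed.

(** * The initial value problem: existence, regularity and a priori bounds *)

Section CauchyProblem.
Hypothesis m0 : (0 < m)%N.

(** Supplies the data of the Volterra equation. The summand 1 in L, together with 0 < m, keeps the
    rate l = 4 m L positive even for A = 0. *)
Lemma coefficient_rep k A : inWm a b k A ->
  exists (At : 'I_m -> 'I_m -> R -> C) (L l : R),
  [/\ forall i j, bmc a b (At i j),
      forall i j, (fun t => A t i j) =ae At i j,
      forall i j t, a <= t <= b -> cabs (At i j t) <= L,
      0 <= L & 0 < l /\ l = 4 * m%:R * L].
Proof.
move=> hA.
have ex (ij : 'I_m * 'I_m) : exists hM : (R -> C) * R,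
    [/\ bmc a b hM.1, (fun t => A t ij.1 ij.2) =ae hM.1, 0 <= hM.2 &
      forall t, a <= t <= b -> cabs (hM.1 t) <= hM.2].
  have [h bh Ah] := inW_W0 ab (hA ij.1 ij.2); have [M M0 hM] := bmc_bound bh.
  by exists (h, M).
have [f hf] := choice ex.
pose L := 1 + \sum_ij (f ij).2.
have s0 : 0 <= \sum_ij (f ij).2 by apply: sumr_ge0 => ij _; case: (hf ij).
have L1 : 0 < L by rewrite /L; apply: ltr_pwDl.
exists (fun i j => (f (i, j)).1), L, (4 * m%:R * L); split.
- by move=> i j; case: (hf (i, j)).
- by move=> i j; case: (hf (i, j)).
- move=> i j t tI; have [_ _ _ h] := hf (i, j); apply: le_trans (h t tI) _.
  rewrite /L (bigD1 (i, j)) //= addrCA lerDl addr_ge0 //.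
  by apply: sumr_ge0 => ij _; case: (hf ij).
- exact: ltW.
- by split=> //; rewrite !mulr_gt0 ?ltr0n.
Qed.

(** Bootstrap: when Y has order j <= k, so has Z = F - A Y, and then Y has order j + 1. *)
Lemma ode_regular k A F q Z Y : inWm a b k A -> inWv a b k F -> vprs q Z Y ->
  Z =ae (fun t => F t - A t *m Y t) -> inWv a b k.+1 Y.
Proof.
move=> hA hF p e; apply: (inWvS p).
elim: k hA hF => [|k IH] hA hF; first exact: vprs_inW0 p.
have hY := inWvS p (IH (inWm_mono hA) (inWv_mono hF)).
apply: inWv_ae (aeI_sub _ e) _; first by move=> t _ ->.
by apply: inWvB => //; exact: inWv_mulmx.
Qed.

Lemma ode_exists k A F q : inWm a b k A -> inWv a b k F ->
  exists Y Z, [/\ vprs q Z Y, inWv a b k.+1 Y & Lop a b A Y =ae F].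
Proof.
move=> hA hF; have [At [L [l [bA eA AL L0 [l0 lE]]]]] := coefficient_rep hA.
have exF i : exists h, bmc a b h /\ (fun t => F t i 0) =ae h.
  by have [h bh Fh] := inW_W0 ab (hF i); exists h.
have [Ft hFt] := choice exF.
have bF i : bmc a b (Ft i) by case: (hFt i).
have [y [by_ yE]] := volterra_solvable ab bA AL L0 l0 lE (fun i => q i 0) bF.
pose z i t := Ft i t - \sum_j At i j t * y j t.
pose Z t : 'cV[C]_m := \col_i z i t.
pose Y t : 'cV[C]_m := \col_i (q i 0 + cprim a (z i) t).
have ZE i : (fun t => Z t i 0) = z i by apply/funext => t; rewrite mxE.
have YE i : (fun t => Y t i 0) = (fun t => q i 0 + cprim a (z i) t).
  by apply/funext => t; rewrite mxE.
have bz i : bmc a b (z i) by apply: bmcB => //; apply: bmc_sum => j; exact: bmcM.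
have p : vprs q Z Y by move=> i; rewrite ZE YE; split=> //; exact: ae_refl.
have e : Z =ae (fun t => F t - A t *m Y t).
  apply: aev_comp => i.
  have h1 := aeI_ord (eA i); have [_ h2] := hFt i.
  apply: aeI_sub2 h1 h2 => t tI H1 H2; rewrite /Z !mxE /z H2; congr (_ - _).
  by apply: eq_bigr => j _; rewrite mxE H1 yE.
have hY := ode_regular hA hF p e.
exists Y, Z; split=> //.
by apply: aeI_sub2 (Lop_ae A p) e => t _ -> ->; rewrite subrK.
Qed.

Lemma ode_linf_bound k A : inWm a b k A -> exists2 K : R, 0 <= K &
  forall q Z Y, vprs q Z Y ->
    linfv Y <= K * (linfv (Lop a b A Y) + \sum_i cabs (q i 0)).
Proof.
move=> hA; have [At [L [l [bA eA AL L0 [l0 lE]]]]] := coefficient_rep hA.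
pose K1 : R := 2 * expR (l * (b - a)); pose K2 : R := 1 + 4 * (b - a).
have ba : 0 <= 4 * (b - a) by rewrite mulr_ge0 // subr_ge0 ltW.
have K10 : 0 <= K1 by rewrite mulr_ge0 ?expR_ge0.
have K20 : 0 <= K2 by rewrite addr_ge0.
exists (m%:R * (K1 * K2)); first by rewrite !mulr_ge0.
move=> q Z Y p; set F := Lop a b A Y.
have e := Lop_ae A p; rewrite -/F in e.
have hF : inWv a b 0 F.
  apply: inWv_ae (aeI_sub _ e) _; first by move=> t _ ->.
  apply: inWvD; first exact: vprs_inW0 p.
  apply: inWv_mulmx; first by move=> i j; apply/inW0P; exact: inW_W0 (hA i j).
  by move=> i; apply/inW0P; exact: prs_W0 (p i).
have exF i : exists h, bmc a b h /\ (fun t => F t i 0) =ae h.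
  by have [h bh Fh] := inW_W0 ab (hF i); exists h.
have [Ft hFt] := choice exF.
have bF i : bmc a b (Ft i) by case: (hFt i).
pose y i t := q i 0 + cprim a (fun s => Z s i 0) t.
have bZ i : bmc a b (fun s => Z s i 0) by case: (p i).
have bY i : bmc a b (y i) by exact: bmc_affine.
have Yy i : (fun t => Y t i 0) =ae y i by case: (p i).
(* Every Y solves the equation with right-hand side F = L Y; this is what makes the Volterra bound
   an a priori estimate. *)
have yE i x : a <= x <= b -> y i x = volterra a At Ft (fun i => q i 0) y i x.
  move=> /andP[_ xb]; rewrite /y /volterra; congr (_ + _); apply: bmc_cprim_ae => //.
    by apply: bmcB => //; apply: bmc_sum => j; apply: bmcM => //; exact: bY.
  have [_ h1] := hFt i; have h2 := aeI_and (aeI_ord (eA i)) (aeI_ord Yy).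
  apply: aeI_sub3 e h1 h2 => t _ E1 E2 [E3 E4].
  rewrite -E2 E1 mxE [(A t *m Y t) i 0]mxE -/(y _) -[LHS]addr0 -addrA; congr (_ + _).
  apply/eqP; rewrite eq_sym subr_eq0; apply/eqP; apply: eq_bigr => j _.
  by rewrite E3 E4.
pose al : R := \sum_i cabs (q i 0) + 4 * (b - a) * linfv F.
have lF0 : 0 <= linfv F by apply: sumr_ge0 => i _; exact: linf_ge0.
have q0 : 0 <= \sum_i cabs (q i 0) by apply: sumr_ge0 => i _; exact: cabs_ge0.
have al0 : 0 <= al by rewrite addr_ge0 // mulr_ge0.
have hal i x : a <= x <= b -> cabs (q i 0 + cprim a (Ft i) x) <= al.
  move=> xI; apply: le_trans (cabsD _ _) _; apply: lerD.
    rewrite (bigD1 i) //= lerDl; apply: sumr_ge0 => j _; exact: cabs_ge0.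
  have [_ h] := hFt i.
  apply: le_trans (cprim_le_ae ab (bF i) (linf_ge0 a b _) (linf_ub (bmc_W0 (bF i))) xI) _.
  rewrite -(linf_ae h) ler_wpM2l // /linfv (bigD1 i) //= lerDl.
  by apply: sumr_ge0 => j _; exact: linf_ge0.
have B := volterra_bound ab bA AL L0 l0 lE bF al0 bY yE hal.
have alK : al <= K2 * (linfv F + \sum_i cabs (q i 0)).
  rewrite /al /K2 [leRHS]mulrDl mul1r (mulrDr (4 * _)); apply: lerD; first by rewrite lerDr.
  by rewrite lerDl mulr_ge0.
apply: (@le_trans _ _ (\sum_(i < m) K1 * al)).
  apply: ler_sum => i _; rewrite (linf_ae (Yy i)); apply: linf_le.
    by rewrite mulr_ge0.
  by apply: aeI_all => t tI; exact: B.
rewrite sumr_const card_ord -[leLHS]mulr_natl -(mulrA m%:R) -(mulrA K1).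
by apply: ler_wpM2l; [exact: ler0n|exact: ler_wpM2l].
Qed.

(** Since Y' = L Y - A Y, a bound on |Y|_k yields one on |Y'|_k, and together with the sup bound one
    on |Y|_(k+1). *)
Lemma ode_bound_lift k A (K : R) : inWm a b k A -> 0 <= K ->
  (forall q Z Y, vprs q Z Y -> inWv a b k.+1 Y ->
    sobnormv a b k Y <= K * (sobnormv a b k (Lop a b A Y) + \sum_i cabs (q i 0))) ->
  exists2 K' : R, 0 <= K' &
  forall q Z Y, vprs q Z Y -> inWv a b k.+1 Y ->
    sobnormv a b k.+1 Y <=
      K' * (sobnormv a b k (Lop a b A Y) + \sum_i cabs (q i 0)).
Proof.
move=> hA K0 hK; have [K' K'0 hK'] := ode_linf_bound hA.
pose c : R := 2 ^+ k * sobnormm a b k A.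
have c0 : 0 <= c by rewrite mulr_ge0 ?exprn_ge0 ?sobnormm_ge0.
exists (K' + 1 + c * K); first by apply: addr_ge0; [exact: addr_ge0|exact: mulr_ge0].
move=> q Z Y p hY; have hL := inWv_Lop hA hY.
have hAY := inWv_mulmx hA (inWv_mono hY).
have e : (fun t => Lop a b A Y t - A t *m Y t) =ae Z.
  by apply: aeI_sub (Lop_ae A p) => t _ ->; rewrite addrK.
have hLA := inWvB hL hAY; have hZ := inWv_ae e hLA.
rewrite (sobnormvS p hZ) (sobnormv_ae e hLA).
have h1 := hK' _ _ _ p; have h2 := hK _ _ _ p hY.
have h3 := sobnormvB hL hAY; have h4 := sobnormv_mulmx hA (inWv_mono hY).
have h5 := linfv_le_sobnormv hL.
have q0 : 0 <= \sum_i cabs (q i 0) by apply: sumr_ge0 => i _; exact: cabs_ge0.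
set Q := \sum_i _ in h1 h2 q0 *; set N := sobnormv a b k (Lop a b A Y) in h2 h3 h5 *.
rewrite 2!mulrDl mul1r -addrA; apply: lerD.
  by apply: le_trans h1 _; rewrite ler_wpM2l // lerD2r.
apply: le_trans h3 _; apply: lerD; first by rewrite lerDl.
by apply: le_trans h4 _; rewrite -/c -mulrA ler_wpM2l.
Qed.

Lemma ode_bound k A : inWm a b k A -> exists2 K : R, 0 <= K &
  forall q Z Y, vprs q Z Y -> inWv a b k.+1 Y ->
    sobnormv a b k.+1 Y <=
      K * (sobnormv a b k (Lop a b A Y) + \sum_i cabs (q i 0)).
Proof.
elim: k => [|k IH] hA.
  have [K K0 hK] := ode_linf_bound hA; apply: (ode_bound_lift hA K0) => q Z Y p hY.
  by rewrite !sobnormv0E; [exact: hK p|exact: inWv_Lop|exact: inWv_mono].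
have [K K0 hK] := IH (inWm_mono hA); apply: (ode_bound_lift hA K0) => q Z Y p hY.
apply: le_trans (hK _ _ _ p (inWv_mono hY)) _.
by rewrite ler_wpM2l // lerD2r; apply: sobnormv_mono; exact: inWv_Lop.
Qed.

End CauchyProblem.

End VectorFunctions.

(** * Bounded operators *)

Section NormLowerBound.
Variables (R : realType) (m : nat).
Notation C := (C R).
Variable p : 'cV[C]_m -> R.
Hypothesis np : is_norm p.

Lemma nrm_ge0 v : 0 <= p v.
Proof. by case: np. Qed.

Lemma nrmD v w : p (v + w) <= p v + p w.
Proof. by case: np => _ [_ []]. Qed.

Lemma nrmZ (l : C) v : p (l *: v) = cabs l * p v.
Proof. by case: np => _ [_ []]. Qed.

Lemma nrm_eq0 v : p v = 0 -> v = 0.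
Proof. by case: np => _ [h _]; exact: h. Qed.

Lemma nrm0 : p 0 = 0.
Proof. by rewrite -(scale0r 0) nrmZ cabs0 mul0r. Qed.

Lemma nrmN v : p (- v) = p v.
Proof. by rewrite -scaleN1r nrmZ cabsN cabs1 mul1r. Qed.

Lemma nrmB v w : p (v - w) <= p v + p w.
Proof. by rewrite -(nrmN w); exact: nrmD. Qed.

Lemma nrm_subl v w : p v - p w <= p (v - w).
Proof. by rewrite lerBlDr; apply: le_trans (nrmD _ _); rewrite subrK. Qed.

Lemma nrm_sum (J : Type) (r : seq J) (F : J -> 'cV[C]_m) :
  p (\sum_(j <- r) F j) <= \sum_(j <- r) p (F j).
Proof.
elim: r => [|j r IH]; first by rewrite !big_nil nrm0.
by rewrite !big_cons; apply: le_trans (nrmD _ _) _; rewrite lerD2l.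
Qed.

(** Real coordinates on C^m, which give access to the compactness of the real unit sphere. *)
Let phi (v : 'rV[R]_(m + m)) : 'cV[C]_m :=
  \col_i Complex (v 0 (lshift m i)) (v 0 (rshift m i)).

Let rv_entry (v : 'rV[R]_(m + m)) j : `|v 0 j| <= `|v|.
Proof.
have h : `|v 0 j| \in [seq `|v x.1 x.2| | x : 'I_1 * 'I_(m + m)].
  by apply/mapP; exists (ord0, j) => //=; rewrite mem_enum.
by rewrite [leRHS]/Num.norm /= mx_normrE; apply/bigmax_geP; right; exists (ord0, j).
Qed.

Let phiB v w : phi (v - w) = phi v - phi w.
Proof. by apply/colP => i; rewrite !mxE. Qed.

Let phiZ (t : R) v : phi (t *: v) = Complex t 0 *: phi v.
Proof.
by apply/colP => i; rewrite !mxE; apply: complexP; rewrite /= ?ReM ?ImM /= mul0r ?subr0 ?addr0.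
Qed.

Let phi_lip : exists2 K : R, 0 <= K & forall v, p (phi v) <= K * `|v|.
Proof.
exists (\sum_i 2 * p (delta_mx i 0)).
  by apply: sumr_ge0 => i _; rewrite mulr_ge0 ?nrm_ge0.
move=> v; rewrite {1}(matrix_sum_delta (phi v)).
apply: le_trans (nrm_sum _ _) _; rewrite mulr_suml; apply: ler_sum => i _.
rewrite big_ord1 nrmZ mulrAC ler_wpM2r ?nrm_ge0 //.
apply: le_trans (cabs_le_ReIm _) _; rewrite mxE /= mulr_natl mulr2n.
by apply: lerD; exact: rv_entry.
Qed.

Let phi_continuous : continuous (fun v => p (phi v)).
Proof.
have [K K0 hK] := phi_lip.
have K1 : 0 < K + 1 by exact: ltr_wpDl.
move=> v.
apply: (proj2 (@cvgrPdist_le R R 'rV[R]_(m + m) (nbhs v) _ (fun v => p (phi v)) (p (phi v)))) => e e0.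
have d0 : 0 < e / (K + 1) by rewrite divr_gt0.
have : nbhs v (ball v (e / (K + 1))) by exact: nbhsx_ballx.
apply: filterS => w; rewrite -ball_normE /= => /ltW hw.
have h : `|p (phi v) - p (phi w)| <= p (phi (v - w)).
  rewrite phiB ler_norml nrm_subl andbT lerNl opprB.
  by rewrite -(nrmN (phi v - phi w)) opprB nrm_subl.
apply: le_trans h _; apply: le_trans (hK _) _.
apply: (@le_trans _ _ ((K + 1) * `|v - w|)); first by rewrite ler_wpM2r // lerDl.
by rewrite mulrC -ler_pdivlMr.
Qed.

(** The norm is Lipschitz in real coordinates, so it maps the compact unit sphere onto a closed set,
    which misses 0 by definiteness. Homogeneity extends the resulting lower bound to all vectors. *)
Lemma norm_lower : exists2 c : R, 0 < c &
  forall q : 'cV[C]_m, c * \sum_i cabs (q i 0) <= p q.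
Proof.
pose S := [set v : 'rV[R]_(m + m) | `|v| = 1].
have cS : compact S.
  apply: bounded_closed_compact.
    by exists 1; split=> // x x1 v /= ->; exact: ltW.
  have -> : S = (fun v : 'rV[R]_(m + m) => `|v|) @^-1` [set 1] by [].
  apply: closed_comp; last exact: closed_eq.
  by move=> v _; exact: norm_continuous.
have cI : closed ((fun v => p (phi v)) @` S).
  apply: compact_closed; first exact: Rhausdorff.
  apply: continuous_compact => //; apply: continuous_subspaceT; exact: phi_continuous.
have n0 : (~` ((fun v => p (phi v)) @` S)) 0.
  move=> [v /= v1 /nrm_eq0 v0].
  have : v = 0.
    apply/rowP => j; rewrite mxE; case: (split_ordP j) => i ->.
      by move: v0 => /colP/(_ i); rewrite !mxE => -[].
    by move: v0 => /colP/(_ i); rewrite !mxE => -[].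
  move=> v0'; move: v1; rewrite /S /= v0' normr0 => /eqP; rewrite eq_sym oner_eq0 //.
have [e /= e0 he] : exists2 e : R, 0 < e & forall x, `|x| < e ->
    ~ ((fun v => p (phi v)) @` S) x.
  have := closed_openC cI; rewrite openE => /(_ 0 n0) [e /= e0 he].
  by exists e => // x xe; apply: he; rewrite /ball /= sub0r normrN.
have lowS v : `|v| = 1 -> e <= p (phi v).
  move=> v1; rewrite leNgt; apply/negP => h; apply: (he (p (phi v))); last by exists v.
  by rewrite ger0_norm // nrm_ge0.
have low v : e * `|v| <= p (phi v).
  have [->|v0] := eqVneq v 0; first by rewrite normr0 mulr0 nrm_ge0.
  have nv0 : 0 < `|v| by rewrite normr_gt0.
  have := lowS (`|v|^-1 *: v).
  rewrite normrZ normfV normr_id mulVf ?gt_eqF // => /(_ erefl).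
  rewrite phiZ nrmZ.
  have -> : cabs (Complex `|v|^-1 0 : C) = `|v|^-1.
    by rewrite /cabs /= expr0n addr0 sqrtr_sqr ger0_norm // invr_ge0 ltW.
  by rewrite mulrC ler_pdivlMr.
(* The sum of the |q_i| is at most 2 m times the max norm of the real coordinates; the added 1 keeps
   the divisor positive for m = 0. *)
have K0 : 0 < \sum_(i < m) (2 : R) + 1.
  by apply: ltr_wpDl => //; apply: sumr_ge0.
exists (e / (\sum_(i < m) (2 : R) + 1)); first by rewrite divr_gt0.
move=> q; pose v : 'rV[R]_(m + m) :=
  row_mx (\row_i complex.Re (q i 0)) (\row_i complex.Im (q i 0)).
have qE : q = phi v.
  by apply/colP => i; rewrite mxE row_mxEl row_mxEr !mxE; case: (q i 0).
apply: le_trans (_ : e * `|v| <= _); last by rewrite qE.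
rewrite -mulrA ler_wpM2l ?(ltW e0) // mulrC ler_pdivrMr //.
rewrite mulrDr mulr1 -[leLHS]addr0; apply: lerD => //; rewrite mulr_sumr.
apply: ler_sum => i _; apply: le_trans (cabs_le_ReIm _) _.
rewrite mulr_natr mulr2n; apply: lerD.
  by have := rv_entry v (lshift m i); rewrite /v row_mxEl mxE.
by have := rv_entry v (rshift m i); rewrite /v row_mxEr mxE.
Qed.

End NormLowerBound.

(** * Operator norms and the Banach-Steinhaus theorem *)

Section BoundedOperators.
Variables (R : realType) (a b : R) (k m : nat).
Hypothesis ab : a < b.
Notation C := (C R).
Variable nrm : 'cV[C]_m -> R.
Hypothesis np : is_norm nrm.
Implicit Types (T : (R -> 'cV[C]_m) -> 'cV[C]_m) (y z w : R -> 'cV[C]_m).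
Notation W := (inWv a b k).
Notation N := (sobnormv a b k).

Lemma blin_lin T (l : C) y z : bounded_linear_op a b k nrm T -> W y -> W z ->
  T (fun t => l *: y t + z t) = l *: T y + T z.
Proof. by move=> [h _]; exact: h. Qed.

Lemma blin0 T : bounded_linear_op a b k nrm T -> T (fun=> 0) = 0.
Proof.
move=> hT; have h0 := inWv_cst ab k (0 : 'cV[C]_m).
have := blin_lin (- 1) hT h0 h0; rewrite (scaleN1r (T _)) addNr => E; rewrite -[RHS]E.
by congr T; apply/funext => t; rewrite scaler0 addr0.
Qed.

Lemma blinD T y z : bounded_linear_op a b k nrm T -> W y -> W z ->
  T (fun t => y t + z t) = T y + T z.
Proof.
move=> hT hy hz; have := blin_lin 1 hT hy hz; rewrite scale1r => <-.
by congr T; apply/funext => t; rewrite scale1r.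
Qed.

Lemma blinB T y z : bounded_linear_op a b k nrm T -> W y -> W z ->
  T (fun t => y t - z t) = T y - T z.
Proof.
move=> hT hy hz; have := blin_lin (- 1) hT hz hy; rewrite scaleN1r addrC => <-.
by congr T; apply/funext => t; rewrite scaleN1r addrC.
Qed.

Lemma blinZ T (l : C) y : bounded_linear_op a b k nrm T -> W y ->
  T (fun t => l *: y t) = l *: T y.
Proof.
move=> hT hy; have := blin_lin l hT hy (inWv_cst ab k 0).
rewrite (blin0 hT) addr0 => <-.
by congr T; apply/funext => t; rewrite addr0.
Qed.

Lemma blin_sum T (J : Type) (r : seq J) (q : J -> C) (U : J -> R -> 'cV[C]_m) :
  bounded_linear_op a b k nrm T -> (forall j, W (U j)) ->
  T (fun t => \sum_(j <- r) q j *: U j t) = \sum_(j <- r) q j *: T (U j).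
Proof.
move=> hT hU; elim: r => [|j r IH].
  have -> : (fun t => \sum_(j <- [::]) q j *: U j t) = fun=> 0.
    by apply/funext => t; rewrite big_nil.
  by rewrite big_nil blin0.
rewrite big_cons -IH -(blin_lin (q j) hT (hU j)); last first.
  by apply: inWv_sum => // i; exact: inWvZ.
by congr T; apply/funext => t; rewrite big_cons.
Qed.

(** K is the supremum of |T w| over the unit ball. It need not be attained, but half of it is, which
    suffices for a gliding hump. *)
Lemma operator_norm T : bounded_linear_op a b k nrm T ->
  exists K : R, [/\ 0 <= K, forall y, W y -> nrm (T y) <= K * N y &
    0 < K -> exists w, [/\ W w, N w <= 1 & K / 2 <= nrm (T w)]].
Proof.
move=> hT; have [_ [K0 hK0]] := hT.
pose E := [set x : R | exists w, [/\ W w, N w <= 1 & x = nrm (T w)]].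
have N0 : N (fun=> 0 : 'cV[C]_m) = 0 by exact: sobnormv_cst0.
have E0 : E 0.
  exists (fun=> 0); split; rewrite ?N0 ?(blin0 hT) ?(nrm0 np) //.
  exact: inWv_cst.
have ubE : ubound E `|K0|.
  move=> x [w [hw w1 ->]]; apply: le_trans (hK0 w hw) _.
  apply: le_trans (ler_norm _) _; rewrite normrM ler_piMr //.
  by rewrite ger0_norm // sobnormv_ge0.
have sE : has_sup E by split; [exists 0|exists `|K0|].
exists (sup E); split.
- by apply: ub_le_sup => //; exists `|K0|.
(* A function of norm 0 cannot be normalised; there the given bound of T decides. *)
- move=> y hy; have := sobnormv_ge0 a b k y; rewrite le_eqVlt => /predU1P[y0|y0].
    by rewrite -y0 mulr0; apply: le_trans (hK0 y hy) _; rewrite -y0 mulr0.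
  pose l : C := Complex (N y)^-1 0.
  have lE : cabs l = (N y)^-1.
    by rewrite /cabs /= expr0n addr0 sqrtr_sqr ger0_norm // invr_ge0 ltW.
  have : nrm (T (fun t => l *: y t)) <= sup E.
    apply: ub_le_sup; first by exists `|K0|.
    exists (fun t => l *: y t); split=> //; first exact: inWvZ.
    by apply: le_trans (sobnormvZ ab l hy) _; rewrite lE mulVf ?gt_eqF.
  by rewrite (blinZ l hT hy) (nrmZ np) lE mulrC ler_pdivrMr.
- move=> s0; have [|x [w [hw w1 ->]] h] := @sup_adherent R E (sup E / 2) _ sE.
    by rewrite divr_gt0.
  exists w; split=> //; apply: le_trans (ltW h).
  by rewrite {2}[sup E]splitr addrK.
Qed.

Lemma sobnormv_complete : exists2 K : R, 0 <= K &
  forall (u : nat -> R -> 'cV[C]_m) (th : R), 0 < th <= 2^-1 ->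
    (forall i, W (u i) /\ N (u i) <= th ^+ i) ->
    exists2 y, W y &
      forall n, N (fun t => y t - \sum_(i < n) u i t) <= K * th ^+ n.
Proof.
have [K K0 hK] := sobnorm_complete ab k.
exists (m%:R * K); first by rewrite mulr_ge0.
move=> u th th01 hu.
have ex (j : 'I_m) : exists y : R -> C, inW a b k y /\
    forall n, sobnorm a b k (fun t => y t - \sum_(i < n) u i t j 0) <= K * th ^+ n.
  have [|y hy Hy] := hK (fun i t => u i t j 0) th th01; last by exists y.
  move=> i; have [h1 h2] := hu i; split; first exact: h1.
  exact: le_trans (sobnorm_le_sobnormv _ _ _ (u i) j) h2.
have [y hy] := choice ex.
exists (fun t => \col_j y j t).
  move=> j; have [h _] := hy j.
  by have -> : (fun t => (\col_j y j t) j 0) = y j by apply/funext => t; rewrite mxE.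
move=> n; rewrite -mulrA mulr_natl -[in leRHS](card_ord m) -sumr_const.
apply: ler_sum => j _; have [_ h] := hy j.
have -> : (fun t => (\col_j y j t - \sum_(i < n) u i t) j 0) =
    (fun t => y j t - \sum_(i < n) u i t j 0).
  by apply/funext => t; rewrite !mxE summxE.
exact: h.
Qed.

(* Gliding hump: [x n.+1 = x n +- th^n w n], the sign being chosen so that
   [T n] does not shrink; the tail of the series is too small to cancel the
   contribution of the n-th term. *)
Lemma uniform_boundedness (T : nat -> (R -> 'cV[C]_m) -> 'cV[C]_m) :
  (forall i, bounded_linear_op a b k nrm (T i)) ->
  (forall y, W y -> exists M : R, forall i, nrm (T i y) <= M) ->
  exists M : R, forall i y, W y -> nrm (T i y) <= M * N y.
Proof.
move=> hT pb; apply: contrapT => /forallNP unb.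
have [Cc Cc0 complete] := sobnormv_complete.
(* Small enough for th <= 1/2, required by completeness, and for Cc * th <= 1/4, which keeps the
   tail below half of the lower bound th^n K_n / 2 for the n-th hump. *)
pose th : R := (4 * Cc + 4)^-1.
have D0 : 0 < 4 * Cc + 4 by apply: ltr_wpDl => //; exact: mulr_ge0.
have th0 : 0 < th by rewrite invr_gt0.
have th2 : th <= 2^-1.
  rewrite lef_pV2 ?posrE //; apply: le_trans (_ : 4 <= _); first by rewrite ler_nat.
  by rewrite lerDr mulr_ge0.
have Cth : Cc * th <= 4^-1.
  rewrite ler_pdivrMr // mulrDr mulrA mulVf ?pnatr_eq0 // mul1r lerDl.
  by rewrite ?mulr_ge0 ?invr_ge0.
(* Operator norms of at least n / th^n, so that th^n K_n / 4, which survives the tail, is still at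
   least n / 4. *)
have ex (n : nat) : exists iwK : nat * (R -> 'cV[C]_m) * R,
    [/\ W iwK.1.2, N iwK.1.2 <= 1, iwK.2 / 2 <= nrm (T iwK.1.1 iwK.1.2),
        n%:R / th ^+ n <= iwK.2 &
        forall y, W y -> nrm (T iwK.1.1 y) <= iwK.2 * N y].
  have [i [K [Kn hK hw]]] : exists i K, [/\ n%:R / th ^+ n < K,
      forall y, W y -> nrm (T i y) <= K * N y &
      0 < K -> exists w, [/\ W w, N w <= 1 & K / 2 <= nrm (T i w)]].
    apply: contrapT => /forallNP h; apply: (unb (n%:R / th ^+ n)) => i y hy.
    have [K [K0 hK hw]] := operator_norm (hT i).
    have KM : K <= n%:R / th ^+ n.
      by rewrite leNgt; apply/negP => KM; apply: (h i); exists K.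
    by apply: le_trans (hK y hy) _; rewrite ler_wpM2r ?sobnormv_ge0.
  have [|w [w1 w2 w3]] := hw.
    by apply: le_lt_trans Kn; rewrite divr_ge0 // exprn_ge0 // ltW.
  by exists (i, w, K); split=> //=; exact: ltW.
have [f hf] := choice ex.
pose S n := T (f n).1.1; pose K n := (f n).2.
pose xi n t := Complex (th ^+ n) 0 *: (f n).1.2 t : 'cV[C]_m.
have cth n : cabs (Complex (th ^+ n) 0 : C) = th ^+ n.
  by rewrite /cabs /= expr0n addr0 sqrtr_sqr ger0_norm // exprn_ge0 // ltW.
have Wf n : W (f n).1.2 by case: (hf n).
have Wxi n : W (xi n) by exact: inWvZ.
have Nxi n : N (xi n) <= th ^+ n.
  apply: le_trans (sobnormvZ ab _ (Wf n)) _; rewrite cth.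
  by rewrite ler_piMr ?exprn_ge0 ?(ltW th0) //; case: (hf n).
have Sxi n : th ^+ n * (K n / 2) <= nrm (S n (xi n)).
  rewrite /S /xi (blinZ _ (hT _) (Wf n)) (nrmZ np) cth ler_wpM2l ?exprn_ge0 ?(ltW th0) //.
  by case: (hf n).
pose sg n x : C := if nrm (S n (xi n)) <= nrm (S n (fun t => x t + xi n t)) then 1 else -1.
pose x := fix x n : R -> 'cV[C]_m :=
  if n is n'.+1 then fun t => x n' t + sg n' (x n') *: xi n' t else fun=> 0.
have Wx n : W (x n).
  elim: n => [|n IH] /=; first exact: inWv_cst.
  by apply: inWvD => //; exact: inWvZ.
(* One of the signs works because 2 |S xi| <= |S (x + xi)| + |S (x - xi)|. *)
have Sx n : nrm (S n (xi n)) <= nrm (S n (x n.+1)).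
  rewrite /= /sg; case: ifP => [|/negbT]; rewrite -?ltNge.
    by move=> h; apply: le_trans h _; under [X in S n X]eq_fun do rewrite -[xi n _]scale1r.
  move=> h; have -> : (fun t => x n t + -1 *: xi n t) = (fun t => x n t - xi n t).
    by apply/funext => t; rewrite scaleN1r.
  move: h; rewrite /S (blinD (hT _) (Wx n) (Wxi n)) (blinB (hT _) (Wx n) (Wxi n)).
  set X := T _ (x n); set Y := T _ (xi n) => h.
  have : nrm (Y + Y) <= nrm (X + Y) + nrm (X - Y).
    have -> : Y + Y = (X + Y) - (X - Y) by rewrite opprB [RHS]addrC subrKA.
    exact: nrmB.
  have -> : nrm (Y + Y) = nrm Y + nrm Y.
    rewrite -mulr2n -scaler_nat (nrmZ np).
    have -> : (2%:R : C) = Complex (2 : R) 0 by apply: complexP; rewrite /= ?addr0.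
    by rewrite /cabs /= expr0n addr0 sqrtr_sqr ger0_norm // mulr_natl mulr2n.
  by move=> h2; move: (ltW h) h2; move: (nrm Y) (nrm (X + Y)) (nrm (X - Y)) => r s u; lra.
pose u n t := sg n (x n) *: xi n t.
have xE n t : x n t = \sum_(i < n) u i t.
  by elim: n => [|n IH]; rewrite ?big_ord0 // big_ord_recr /= -IH.
have [||y Wy hy] := complete u th; first by rewrite th0.
  move=> n; split; first exact: inWvZ.
  apply: le_trans (sobnormvZ ab _ (Wxi n)) _.
  have -> : cabs (sg n (x n)) = 1 by rewrite /sg; case: ifP; rewrite ?cabsN cabs1.
  by rewrite mul1r.
have low n : n%:R / 4 <= nrm (S n y).
  have hS := hT (f n).1.1.
  have Wd : W (fun t => y t - x n.+1 t) by exact: inWvB.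
  have h1 : nrm (S n (x n.+1)) - nrm (S n (fun t => y t - x n.+1 t)) <= nrm (S n y).
    rewrite lerBlDr; apply: le_trans (nrmB np _ _).
    by rewrite /S (blinB hS Wy (Wx n.+1)) opprB addrC subrK.
  have [_ _ _ Kn hK] := hf n; rewrite -/(K n) in Kn hK.
  have K0 : 0 <= K n.
    by apply: le_trans Kn; rewrite divr_ge0 // exprn_ge0 // ltW.
  have h2 : nrm (S n (fun t => y t - x n.+1 t)) <= K n * (Cc * th ^+ n.+1).
    apply: le_trans (hK _ Wd) _; rewrite ler_wpM2l //.
    by have := hy n.+1; under eq_fun do rewrite -xE.
  have h3 : K n * (Cc * th ^+ n.+1) <= th ^+ n * (K n / 4).
    have -> : K n * (Cc * th ^+ n.+1) = th ^+ n * K n * (Cc * th) by rewrite exprS; ring.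
    by rewrite [leRHS]mulrA ler_wpM2l // mulr_ge0 // exprn_ge0 // ltW.
  have h4 : n%:R / 4 <= th ^+ n * (K n / 4).
    rewrite mulrA ler_wpM2r ?invr_ge0 //.
    by rewrite mulrC -ler_pdivrMr // exprn_gt0.
  apply: le_trans h1; apply: le_trans h4 _; rewrite lerBrDr.
  apply: le_trans (Sx n); apply: le_trans (Sxi n).
  apply: le_trans (_ : th ^+ n * (K n / 4) + th ^+ n * (K n / 4) <= _).
    by rewrite lerD2l; exact: le_trans h2 h3.
  by rewrite le_eqVlt; apply/orP; left; apply/eqP; field.
have [M hM] := pb y Wy.
have := truncnS_gt (4 * M); set n := (Num.truncn _).+1 => nM.
have := le_trans (low n) (hM _).
by rewrite ler_pdivrMr // mulrC leNgt nM.
Qed.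

End BoundedOperators.

(** * Boundary value problems *)

(** Here n = |w|, x = |L(0) w|, x' = |L(e) w|, be = |B(e) w| and s = |A(e) - A(0)|. Smallness of s
    gives K p s n <= n / 2, which moves to the left and doubles K. *)
Lemma absorb_perturbation (R : realFieldType) (n K p s x x' be : R) :
  0 < K -> 0 < p -> 0 <= n -> s < (2 * (K * p))^-1 -> x <= x' + p * s * n ->
  n <= K * (x + be) -> n <= 2 * K * (x' + be).
Proof.
move=> K0 p0 n0 hs hx hn; have P0 : 0 < K * p by rewrite mulr_gt0.
have h1 : K * (p * s * n) <= n / 2.
  have -> : K * (p * s * n) = n * (s * (K * p)) by ring.
  apply: ler_wpM2l => //; rewrite -ler_pdivlMr //; apply: le_trans (ltW hs) _.
  by rewrite invfM.
have h2 : K * (x + be) <= K * (x' + be) + K * (p * s * n).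
  by rewrite -mulrDr ler_wpM2l ?(ltW K0) // addrAC lerD2r.
by rewrite -mulrA; move: (K * (x' + be)) (K * (x + be)) (K * (p * s * n)) hn h1 h2;
  clear; move=> u v w; lra.
Qed.

Section BoundaryProblem.
Variables (R : realType) (a b : R) (k m : nat).
Hypothesis ab : a < b.
Hypothesis m0 : (0 < m)%N.
Notation C := (C R).
Variable nrm : 'cV[C]_m -> R.
Hypothesis np : is_norm nrm.
Notation "f =ae g" := (aeI a b (fun t => f t = g t)) (at level 70).
Implicit Types (A : R -> 'M[C]_m) (B : (R -> 'cV[C]_m) -> 'cV[C]_m).
Implicit Types (y z w f : R -> 'cV[C]_m) (q c : 'cV[C]_m).
Notation W := (inWv a b k.+1).
Notation N := (sobnormv a b k.+1).

Lemma inWv_W1 y : W y -> inWv a b 1 y.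
Proof.
by move=> /inWvS_elim[q [z [p _]]]; exact: inWvS p (vprs_inW0 p).
Qed.

Lemma solutionP A B f c y :
  is_solution a b k.+1 A B f c y <-> [/\ W y, Lop a b A y =ae f & B y = c].
Proof.
split => [[h1 [h2 h3]]|[h1 h2 h3]].
  by split=> //; apply/aeI_oo.
by split=> //; split=> //; apply/aeI_oo.
Qed.

Lemma sobnormv_eq0 y : W y -> N y = 0 -> y =ae (fun=> 0).
Proof.
move=> hy y0; apply: aev_comp => i.
have z0 : linf a b (fun t => y t i 0) = 0.
  apply/eqP; rewrite eq_le linf_ge0 andbT.
  apply: le_trans (linf_le_sobnorm ab (hy i)) _; rewrite -y0.
  exact: sobnorm_le_sobnormv.
apply: aeI_sub (linf_ub (inW_W0 ab (hy i))) => t _; rewrite z0 mxE => h.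
by apply: cabs_eq0; apply/eqP; rewrite eq_le h cabs_ge0.
Qed.

Lemma LopB A y z : W y -> W z ->
  Lop a b A (fun t => y t - z t) =ae (fun t => Lop a b A y t - Lop a b A z t).
Proof.
move=> hy hz; rewrite subE.
have := Lop_lin ab A (- 1) (inWv_W1 hz) (inWv_W1 hy).
by apply: aeI_sub => t _ ->; rewrite scaleN1r addrC.
Qed.

Definition lincomb (U : 'I_m -> R -> 'cV[C]_m) q t := \sum_j q j 0 *: U j t.

(** The columns start from the unit vectors at a, so [lincomb U q] is a homogeneous solution with
    initial value q. *)
Lemma fundamental_system A : inWm a b k A ->
  exists U : 'I_m -> R -> 'cV[C]_m, (forall j, W (U j)) /\
  forall q, Lop a b A (lincomb U q) =ae (fun=> 0) /\ exists z, vprs a b q z (lincomb U q).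
Proof.
move=> hA.
have ex j : exists UZ : (R -> 'cV[C]_m) * (R -> 'cV[C]_m),
    [/\ vprs a b (delta_mx j 0) UZ.2 UZ.1, W UZ.1 & Lop a b A UZ.1 =ae (fun=> 0)].
  have [y [z [p hy e]]] := ode_exists ab m0 (delta_mx j 0) hA (inWv_cst ab k 0).
  by exists (y, z).
have [f hf] := choice ex; exists (fun j => (f j).1).
split=> [j|q]; first by case: (hf j).
pose z t : 'cV[C]_m := \sum_j q j 0 *: (f j).2 t.
have p : vprs a b q z (lincomb (fun j => (f j).1) q).
  move=> i.
  have pj j : prs a b (q j 0 * (delta_mx j 0 : 'cV[C]_m) i 0)
      (fun t => q j 0 * (f j).2 t i 0) (fun t => q j 0 * (f j).1 t i 0).
    have [h _ _] := hf j.
    have := prs_lin ab (q j 0) (h i) (prs0 ab); rewrite addr0.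
    under [X in prs _ _ _ X _ -> _]eq_fun do rewrite addr0.
    by under [X in prs _ _ _ _ X -> _]eq_fun do rewrite addr0.
  have := prs_sum ab (index_enum 'I_m) pj.
  have -> : \sum_j q j 0 * (delta_mx j 0 : 'cV[C]_m) i 0 = q i 0.
    rewrite (bigD1 i) //= big1 ?addr0 ?mxE ?eqxx ?mulr1 // => j ji.
    by rewrite mxE eq_sym (negbTE ji) mulr0.
  have -> : (fun t => \sum_j q j 0 * (f j).2 t i 0) = (fun t => z t i 0).
    by apply/funext => t; rewrite /z summxE; apply: eq_bigr => j _; rewrite mxE.
  have -> // : (fun t => \sum_j q j 0 * (f j).1 t i 0) =
      (fun t => lincomb (fun j => (f j).1) q t i 0).
  by apply/funext => t; rewrite /lincomb summxE; apply: eq_bigr => j _; rewrite mxE.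
split; last by exists z.
have H : aeI a b (fun t => forall j, (f j).2 t + A t *m (f j).1 t = 0).
  apply: aeI_ord => j; have [h _ e] := hf j.
  by apply: aeI_sub2 (Lop_ae ab A h) e => t _ <-.
apply: aeI_sub2 (Lop_ae ab A p) H => t _ -> H.
rewrite /z /lincomb mulmx_sumr -big_split /= big1 // => j _.
by rewrite -scalemxAr -scalerDr H scaler0.
Qed.

Lemma inWv_lincomb U q : (forall j, W (U j)) -> W (lincomb U q).
Proof. by move=> hU; apply: inWv_sum => // j; exact: inWvZ. Qed.

Lemma blin_lincomb B U q : bounded_linear_op a b k.+1 nrm B -> (forall j, W (U j)) ->
  B (lincomb U q) = \sum_j q j 0 *: B (U j).
Proof. by move=> hB hU; exact: (blin_sum ab _ (fun j => q j 0) hB hU). Qed.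

(** If B U q = 0, then U q solves the homogeneous problem and vanishes, and so does its initial
    value q. *)
Lemma boundary_matrix_inj A B U : bounded_linear_op a b k.+1 nrm B ->
  (forall y, is_solution a b k.+1 A B (fun=> 0) 0 y -> y =ae (fun=> 0)) ->
  (forall j, W (U j)) ->
  (forall q, Lop a b A (lincomb U q) =ae (fun=> 0) /\
    exists z, vprs a b q z (lincomb U q)) ->
  forall q, B (lincomb U q) = 0 -> q = 0.
Proof.
move=> hB triv hU HU q Bq; have [Lq [z pz]] := HU q.
have e : lincomb U q =ae (fun=> 0).
  by apply: triv; apply/solutionP; split=> //; exact: inWv_lincomb.
have p0 : vprs a b (0 : 'cV[C]_m) (fun=> 0) (fun=> 0).
  move=> i; have -> : (fun t : R => (0 : 'cV[C]_m) i 0) = (fun=> 0).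
    by apply/funext => t; rewrite mxE.
  by rewrite mxE; exact: prs0.
by have [] := vprs_inj ab e pz p0.
Qed.

(** A particular solution y with y(a) = 0 is corrected by U q, where q solves M q = c - B y for the
    boundary matrix M. *)
Lemma boundary_problem_solvable A B : inWm a b k A ->
  bounded_linear_op a b k.+1 nrm B ->
  (forall y, is_solution a b k.+1 A B (fun=> 0) 0 y -> y =ae (fun=> 0)) ->
  forall f c, inWv a b k f -> exists y, is_solution a b k.+1 A B f c y.
Proof.
move=> hA hB triv f c hf.
have [U [hU HU]] := fundamental_system hA.
have inj := boundary_matrix_inj hB triv hU HU.
pose M : 'M[C]_m := \matrix_(i, j) B (U j) i 0.
have BM q : B (lincomb U q) = M *m q.
  rewrite (blin_lincomb q hB hU); apply/colP => i; rewrite summxE mxE.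
  by apply: eq_bigr => j _; rewrite !mxE mulrC.
(* An injective square matrix is invertible; the transposes translate between column vectors and row
   kernels. *)
have Mu : M \in unitmx.
  rewrite -unitmx_tr -row_free_unit -kermx_eq0; apply/rowV0P => v /sub_kermxP vM.
  apply: trmx_inj; rewrite trmx0; apply: inj; rewrite BM.
  by apply: trmx_inj; rewrite trmx_mul trmxK vM trmx0.
have [y [z [p hy e]]] := ode_exists ab m0 0 hA hf.
pose q := invmx M *m (c - B y).
have hq := inWv_lincomb q hU.
exists (fun t => lincomb U q t + y t); apply/solutionP; split.
- exact: inWvD.
- have [Lq _] := HU q.
  have -> : (fun t => lincomb U q t + y t) = (fun t => 1 *: lincomb U q t + y t).
    by apply/funext => t; rewrite scale1r.
  apply: aeI_sub3 (Lop_lin ab A 1 (inWv_W1 hq) (inWv_W1 hy)) Lq e => t _ -> -> ->.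
  by rewrite scaler0 add0r.
- by rewrite (blinD hB hq hy) BM mulKVmx // subrK.
Qed.

(** The derivatives cancel: the two operators differ by multiplication with A' - A. *)
Lemma Lop_perturb A A' w : inWm a b k A -> inWm a b k A' -> W w ->
  sobnormv a b k (Lop a b A' w) <= sobnormv a b k (Lop a b A w) +
    2 ^+ k * sobnormm a b k (fun t => A' t - A t) * N w.
Proof.
move=> hA hA' hw; have hD := inWmB ab hA' hA.
have [q [z [p hz]]] := inWvS_elim hw.
have hL := inWv_Lop ab hA hw; have hDw := inWv_mulmx ab hD (inWv_mono ab hw).
have e : (fun t => Lop a b A w t + (A' t - A t) *m w t) =ae Lop a b A' w.
  apply: aeI_sub2 (Lop_ae ab A p) (Lop_ae ab A' p) => t _ -> ->.
  by rewrite mulmxBl -addrA subrKC.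
rewrite (sobnormv_ae ab e (inWvD ab hL hDw)).
apply: le_trans (sobnormvD ab hL hDw) _; rewrite lerD2l.
apply: le_trans (sobnormv_mulmx ab hD (inWv_mono ab hw)) _.
by rewrite ler_wpM2l ?sobnormv_mono // mulr_ge0 ?exprn_ge0 ?sobnormm_ge0.
Qed.

(** * Uniform estimates in the parameter *)

Section Family.
Variables (eps0 : R) (A : R -> R -> 'M[C]_m).
Variable B : R -> (R -> 'cV[C]_m) -> 'cV[C]_m.
Hypothesis eps0_gt0 : 0 < eps0.
Hypothesis hA : forall e, 0 <= e < eps0 -> inWm a b k (A e).
Hypothesis hB : forall e, 0 <= e < eps0 -> bounded_linear_op a b k.+1 nrm (B e).
Hypothesis triv0 : forall y,
  is_solution a b k.+1 (A 0) (B 0) (fun=> 0) 0 y -> y =ae (fun=> 0).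
Hypothesis cvA : forall d, 0 < d -> exists2 de, 0 < de &
  forall e, 0 < e < de -> e < eps0 -> sobnormm a b k (fun t => A e t - A 0 t) < d.
Hypothesis cvB : forall y, W y -> forall d, 0 < d -> exists2 de, 0 < de &
  forall e, 0 < e < de -> e < eps0 -> nrm (B e y - B 0 y) < d.

Let z0 : 0 <= (0 : R) < eps0.
Proof. by rewrite lexx. Qed.

(** Otherwise each bound n fails for some e_n < eps0 / (n + 1). The sequence B(e_n) is pointwise
    bounded, so Banach-Steinhaus bounds it uniformly, a contradiction. *)
Lemma boundary_operators_bounded : exists de M : R, [/\ 0 < de <= eps0, 0 <= M &
  forall e y, 0 < e < de -> W y -> nrm (B e y) <= M * N y].
Proof.
apply: contrapT => h.
have ex (n : nat) : exists ey : R * (R -> 'cV[C]_m),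
    [/\ 0 < ey.1 < eps0 / n.+1%:R, W ey.2 & n%:R * N ey.2 < nrm (B ey.1 ey.2)].
  apply: contrapT => /forallNP H; apply: h; exists (eps0 / n.+1%:R), n%:R; split=> //.
    by rewrite divr_gt0 //= ler_pdivrMr // ler_peMr ?ler1n // ltW.
  move=> e y he hy; rewrite leNgt; apply/negP => Hlt.
  by apply: (H (e, y)).
have [f hf] := choice ex.
have fe n : 0 < (f n).1 < eps0.
  have [/andP[h1 h2] _ _] := hf n; rewrite h1 (lt_le_trans h2) //.
  by rewrite ler_pdivrMr // ler_peMr ?ler1n // ltW.
have bT n : bounded_linear_op a b k.+1 nrm (B (f n).1).
  by apply: hB; have /andP[h1 h2] := fe n; rewrite h2 ltW.
have [|M hM] := uniform_boundedness ab np bT.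
  move=> y hy; have [de de0 hde] := cvB hy ltr01.
  have nk := truncnS_gt (eps0 / de); set n := (Num.truncn _).+1 in nk.
  (* For i >= n the parameter lies below [de], whence the bound 1 + |B(0) y|; the sum covers the
     finitely many earlier operators. *)
  exists (1 + nrm (B 0 y) + \sum_(i < n) nrm (B (f i).1 y)) => i.
  have s0 : 0 <= \sum_(i < n) nrm (B (f i).1 y).
    by apply: sumr_ge0 => j _; exact: (nrm_ge0 np).
  have [ni|ni] := ltnP i n.
    rewrite (bigD1 (Ordinal ni)) //= addrCA lerDl !addr_ge0 ?(nrm_ge0 np) //.
    by apply: sumr_ge0 => j _; exact: (nrm_ge0 np).
  rewrite -[leLHS]addr0; apply: lerD => //.
  have /andP[f0 f1] := fe i; have [/andP[_ f2] _ _] := hf i.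
  have fd : (f i).1 < de.
    apply: lt_le_trans f2 _; rewrite ler_pdivrMr // mulrC -ler_pdivrMr //.
    by apply: le_trans (ltW nk) _; rewrite ler_nat leqW.
  have := hde (f i).1; rewrite f0 fd => /(_ isT f1) h1.
  rewrite -lerBlDr; apply: le_trans (nrm_subl np _ _) _; exact: ltW.
have nM := truncnS_gt M; set n := (Num.truncn _).+1 in nM.
have [_ h1 h2] := hf n; have := lt_le_trans h2 (hM n _ h1).
rewrite ltNge => /negP; apply; rewrite ler_wpM2r ?sobnormv_ge0 //; exact: ltW.
Qed.

Lemma finite_delta (J : finType) (P : J -> R -> Prop) :
  (forall j, exists2 de : R, 0 < de & forall e, 0 < e < de -> P j e) ->
  exists2 de : R, 0 < de & forall j e, 0 < e < de -> P j e.
Proof.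
move=> H.
have ex j : exists de : R, 0 < de /\ forall e, 0 < e < de -> P j e.
  by have [de h1 h2] := H j; exists de.
have [d hd] := choice ex.
(* 1 / s lies below every d j and replaces their minimum, also for an empty family. *)
pose s := 1 + \sum_j (d j)^-1.
have dj0 j : 0 <= (d j)^-1 by rewrite invr_ge0; case: (hd j) => /ltW.
have s0 : 0 < s by rewrite /s ltr_pwDl // sumr_ge0.
exists s^-1; first by rewrite invr_gt0.
move=> j e /andP[e0 es]; have [d0 hj] := hd j; apply: hj; rewrite e0 /=.
apply: lt_le_trans es _; rewrite -[leRHS]invrK lef_pV2 ?posrE ?invr_gt0 //.
rewrite /s (bigD1 j) //= addrCA lerDl addr_ge0 //.
by apply: sumr_ge0 => i _.
Qed.

(* The map q |-> |B(0) U q| is a norm, hence bounded below on the unit sphere. *)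
Lemma boundary_rank_bound U : (forall j, W (U j)) ->
  (forall q, Lop a b (A 0) (lincomb U q) =ae (fun=> 0) /\
    exists z, vprs a b q z (lincomb U q)) ->
  exists de c : R, [/\ 0 < de <= eps0, 0 < c & forall e, 0 < e < de -> forall q,
    c * \sum_i cabs (q i 0) <= nrm (B e (lincomb U q))].
Proof.
move=> hU HU; have inj := boundary_matrix_inj (hB z0) triv0 hU HU.
pose p q := nrm (B 0 (lincomb U q)).
have linU (l : C) q q' : lincomb U (l *: q + q') =
    (fun t => l *: lincomb U q t + lincomb U q' t).
  apply/funext => t; rewrite /lincomb scaler_sumr -big_split /=.
  by apply: eq_bigr => j _; rewrite !mxE scalerDl scalerA.
have pn : is_norm p.
  split; first by move=> v; exact: (nrm_ge0 np).
  split; first by move=> v /(nrm_eq0 np); exact: inj.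
  split.
    move=> v w; rewrite /p -{1}[v]scale1r linU (blin_lin _ (hB z0)) //;
      try exact: inWv_lincomb.
    by rewrite scale1r; exact: (nrmD np).
  move=> l v; rewrite /p; have -> : lincomb U (l *: v) = (fun t => l *: lincomb U v t).
    by apply/funext => t; rewrite /lincomb scaler_sumr; apply: eq_bigr => j _; rewrite mxE scalerA.
  by rewrite (blinZ ab l (hB z0) (inWv_lincomb v hU)) (nrmZ np).
have [c c0 hc] := norm_lower pn.
(* Half of c is spent on the deviation of B(e) from B(0) on each column; the other half remains as
   the bound. *)
have c20 : 0 < c / 2 by rewrite divr_gt0.
have [|de de0 hde] := @finite_delta 'I_m
  (fun j e => e < eps0 -> nrm (B e (U j) - B 0 (U j)) < c / 2).
  by move=> j; have [de de0 H] := cvB (hU j) c20; exists de.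
exists (Num.min de eps0), (c / 2); split=> //.
  by rewrite lt_min de0 eps0_gt0 ge_min lexx orbT.
move=> e /andP[e0]; rewrite lt_min => /andP[ed ee] q.
have eI : 0 <= e < eps0 by rewrite ltW.
have D : B 0 (lincomb U q) - B e (lincomb U q) =
    - \sum_j q j 0 *: (B e (U j) - B 0 (U j)).
  rewrite (blin_lincomb q (hB z0) hU) (blin_lincomb q (hB eI) hU) -sumrB -sumrN.
  by apply: eq_bigr => j _; rewrite scalerBr opprB.
have h : nrm (B 0 (lincomb U q) - B e (lincomb U q)) <= c / 2 * \sum_i cabs (q i 0).
  rewrite D (nrmN np) mulr_sumr; apply: le_trans (nrm_sum np _ _) _.
  apply: ler_sum => j _; rewrite (nrmZ np) mulrC ler_wpM2r ?cabs_ge0 //.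
  by apply/ltW/hde => //; rewrite e0.
have h1 := hc q; have h2 := nrm_subl np (B 0 (lincomb U q)) (B e (lincomb U q)).
rewrite -/(p q) in h2; have h3 := le_trans h2 h.
have -> : c / 2 * \sum_i cabs (q i 0) =
    c * (\sum_i cabs (q i 0)) - c / 2 * \sum_i cabs (q i 0) by field.
rewrite lerBlDr; apply: le_trans h1 _; rewrite addrC -lerBlDr; exact: h3.
Qed.

Lemma stability : exists de K : R, [/\ 0 < de <= eps0, 0 < K &
  forall e w, 0 < e < de -> W w ->
    N w <= K * (sobnormv a b k (Lop a b (A e) w) + nrm (B e w))].
Proof.
have [U [hU HU]] := fundamental_system (hA z0).
have [d1 [c [/andP[d10 d1e] c0 hc]]] := boundary_rank_bound hU HU.
have [d2 [M [/andP[d20 d2e] M0 hM]]] := boundary_operators_bounded.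
have [KA KA0 hKA] := ode_bound ab m0 (hA z0).
(* With x = |L(0) w|, it combines |w| <= KA (x + |q|) and |q| <= (|B(e) w| + M KA x) / c; the final
   1 makes it positive. *)
pose K2 := KA * (1 + c^-1 * (1 + M * KA)) + 1.
have c10 : 0 <= c^-1 by rewrite invr_ge0 ltW.
have MK0 : 0 <= M * KA by exact: mulr_ge0.
have K20 : 0 < K2.
  by rewrite /K2 ltr_wpDl // mulr_ge0 // addr_ge0 // mulr_ge0 // addr_ge0.
(* The threshold of [absorb_perturbation], with p = 2^k coming from the product estimate. *)
have t0 : 0 < (2 * (K2 * 2 ^+ k))^-1 by rewrite invr_gt0 !mulr_gt0 // exprn_gt0.
have [d3 d30 hd3] := cvA t0.
exists (Num.min d1 (Num.min d2 d3)), (2 * K2); split.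
- by rewrite !lt_min d10 d20 d30 ge_min d1e.
- by rewrite mulr_gt0.
move=> e w /andP[e0]; rewrite !lt_min => /and3P[e1 e2 e3] hw.
have eI : 0 <= e < eps0 by rewrite ltW //= (lt_le_trans e1).
have [q [z [pq hz]]] := inWvS_elim hw.
have [Lq [zq pzq]] := HU q; have hq := inWv_lincomb q hU.
pose v t := w t - lincomb U q t.
have hv : W v by exact: inWvB.
have pv : vprs a b 0 (fun t => - 1 *: zq t + z t) v.
  rewrite /v subE; have := vprs_lin ab (- 1) pzq pq.
  by rewrite scaleN1r addNr.
have Lv : Lop a b (A 0) w =ae Lop a b (A 0) v.
  by apply: aeI_sub2 (LopB (A 0) hw hq) Lq => t _ -> ->; rewrite subr0.
set x := sobnormv a b k (Lop a b (A 0) w).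
have x0 : 0 <= x by exact: sobnormv_ge0.
have be0 : 0 <= nrm (B e w) by exact: (nrm_ge0 np).
have nv : N v <= KA * x.
  apply: le_trans (hKA _ _ _ pv hv) _.
  rewrite (sobnormv_ae ab Lv (inWv_Lop ab (hA z0) hw)) -/x.
  by rewrite big1 ?addr0 // => i _; rewrite mxE cabs0.
have qb : \sum_i cabs (q i 0) <= c^-1 * (nrm (B e w) + M * (KA * x)).
  rewrite -ler_pdivrMl ?invr_gt0 // invrK; apply: le_trans (hc e _ q) _; first by rewrite e0.
  have -> : lincomb U q = (fun t => w t - v t).
    by apply/funext => t; rewrite /v opprB addrC subrK.
  rewrite (blinB (hB eI) hw hv); apply: le_trans (nrmB np _ _) _; rewrite lerD2l.
  apply: le_trans (hM e v _ hv) _; first by rewrite e0.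
  exact: ler_wpM2l.
have wb : N w <= K2 * (x + nrm (B e w)).
  apply: le_trans (hKA _ _ _ pq hw) _; rewrite -/x.
  apply: le_trans (_ : KA * (x + c^-1 * (nrm (B e w) + M * (KA * x))) <= _).
    by rewrite ler_wpM2l // lerD2l.
  have -> : K2 * (x + nrm (B e w)) =
    KA * (x + c^-1 * (nrm (B e w) + M * (KA * x))) +
    ((x + nrm (B e w)) + KA * (c^-1 * x + nrm (B e w) + c^-1 * (M * KA) * nrm (B e w))).
    by rewrite /K2; ring.
  rewrite lerDl; apply: addr_ge0; first exact: addr_ge0.
  apply: mulr_ge0 => //; apply: addr_ge0; first by rewrite addr_ge0 // mulr_ge0.
  by rewrite !mulr_ge0.
have hp := Lop_perturb (hA eI) (hA z0) hw; rewrite -/x in hp.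
(* L(0) w is bounded through L(e) w, so the difference of coefficients appears with the sign
   opposite to that of hypothesis (I). *)
have sE : sobnormm a b k (fun t => A 0 t - A e t) = sobnormm a b k (fun t => A e t - A 0 t).
  apply: eq_bigr => i _; apply: eq_bigr => j _.
  have hd := inWmB ab (hA eI) (hA z0) i j; have hd' := inWmB ab (hA z0) (hA eI) i j.
  have N1 (u u' : R -> C) : inW a b k u -> u' = (fun t => -1 * u t + 0) ->
      sobnorm a b k u' <= sobnorm a b k u.
    move=> hu ->; apply: le_trans (sobnorm_lin ab (-1) hu (inW_cst ab k 0)) _.
    by rewrite sobnorm_cst0 // addr0 cabsN cabs1 mul1r.
  apply/eqP; rewrite eq_le; apply/andP; split; apply: N1 => //;
    by apply/funext => t; rewrite !mxE addr0 mulN1r opprB.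
have ee : e < eps0 by exact: lt_le_trans e1 d1e.
have := hd3 e; rewrite e0 e3 => /(_ isT ee) hs.
rewrite sE in hp.
have Nw0 := sobnormv_ge0 a b k.+1 w.
set s := sobnormm _ _ _ _ in hs hp.
have p0 : 0 < (2 : R) ^+ k by rewrite exprn_gt0.
exact: (absorb_perturbation K20 p0 Nw0 hs hp wb).
Qed.

End Family.

End BoundaryProblem.

(** * Solvability near the limit problem and the two-sided estimate *)

Theorem theorem2 (R : realType) (a b : R) (m n : nat) (eps0 : R)
  (A : R -> R -> 'M[C R]_m)
  (B : R -> (R -> 'cV[C R]_m) -> 'cV[C R]_m)
  (nrm : 'cV[C R]_m -> R) :
  a < b -> (0 < m)%N -> (0 < n)%N -> 0 < eps0 -> is_norm nrm ->
  (* A(.;eps) \in (W^{n-1}_infty)^{m x m} for eps in [0, eps0) *)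
  (forall e, 0 <= e < eps0 -> inWm a b n.-1 (A e)) ->
  (* B(eps) : (W^n_infty)^m -> C^m bounded linear *)
  (forall e, 0 <= e < eps0 -> bounded_linear_op a b n nrm (B e)) ->
  (* (0) the homogeneous limit problem has only the trivial solution *)
  (forall y, is_solution a b n (A 0) (B 0) (fun _ => 0) 0 y ->
     {ae @leb R, forall t, [set` `[a, b]] t -> y t = 0}) ->
  (* (I) A(.;eps) -> A(.;0) in (W^{n-1}_infty)^{m x m} as eps -> 0+ *)
  (forall d, 0 < d -> exists2 de, 0 < de & forall e, 0 < e < de -> e < eps0 ->
     sobnormm a b n.-1 (fun t => A e t - A 0 t) < d) ->
  (* (II) B(eps) y -> B(0) y in C^m as eps -> 0+, for each y *)
  (forall y, inWv a b n y -> forall d, 0 < d ->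
     exists2 de, 0 < de & forall e, 0 < e < de -> e < eps0 ->
       nrm (B e y - B 0 y) < d) ->
  exists eps2 g1 g2 : R,
    [/\ 0 < eps2 <= eps0, 0 < g1, 0 < g2,
     (* unique solvability for eps = 0 and eps in (0, eps2) *)
     (forall e, e = 0 \/ 0 < e < eps2 -> forall f c, inWv a b n.-1 f ->
        (exists y, is_solution a b n (A e) (B e) f c y) /\
        (forall y1 y2, is_solution a b n (A e) (B e) f c y1 ->
           is_solution a b n (A e) (B e) f c y2 ->
           {ae @leb R, forall t, [set` `[a, b]] t -> y1 t = y2 t})) &
     (* two-sided error estimate *)
     (forall e, 0 < e < eps2 ->
      forall (f0 fe : R -> 'cV[C R]_m) (c0 ce : 'cV[C R]_m)
             (y0 ye : R -> 'cV[C R]_m),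
        inWv a b n.-1 f0 -> inWv a b n.-1 fe ->
        is_solution a b n (A 0) (B 0) f0 c0 y0 ->
        is_solution a b n (A e) (B e) fe ce ye ->
        let dt := sobnormv a b n.-1 (fun t => Lop a b (A e) y0 t - fe t)
                  + nrm (B e y0 - ce) in
        g1 * dt <= sobnormv a b n (fun t => y0 t - ye t) <= g2 * dt)].
Proof.
case: n => // k ab m0 _ eps0_gt0 np hA hB triv cvA cvB; rewrite /= in hA cvA *.
have z0 : 0 <= (0 : R) < eps0 by rewrite lexx.
have triv0 y : is_solution a b k.+1 (A 0) (B 0) (fun=> 0) 0 y ->
    aeI a b (fun t => y t = 0) by exact: triv.
have [de [K [/andP[de0 dee] K0 stab]]] :=
  stability ab m0 np eps0_gt0 hA hB triv0 cvA cvB.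
have [dB [M [/andP[dB0 dBe] M0 hM]]] := boundary_operators_bounded ab np eps0_gt0 hB cvB.
have [dA dA0 hdA] := cvA 1 ltr01.
(* A bound of L(e) uniform in e: the first two summands bound L(0), and the last one the
   perturbation when |A(e) - A(0)| < 1. *)
pose L0 := 1 + 2 ^+ k * sobnormm a b k (A 0) + 2 ^+ k.
have L00 : 0 < L0 by rewrite /L0 ltr_wpDl ?exprn_gt0 // addr_ge0 // mulr_ge0 ?exprn_ge0 // sobnormm_ge0.
have LM0 : 0 < L0 + M by exact: ltr_pwDl.
exists (Num.min de (Num.min dB dA)), (L0 + M)^-1, K; split=> //.
- by rewrite !lt_min de0 dB0 dA0 ge_min dee.
- by rewrite invr_gt0.
- move=> e he.
  (* For e = 0 this is hypothesis (0); for e > 0 it is the stability estimate with zero data. *)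
  have [eI trivE] : 0 <= e < eps0 /\ forall y,
      is_solution a b k.+1 (A e) (B e) (fun=> 0) 0 y -> aeI a b (fun t => y t = 0).
    case: he => [->|/andP[e0]]; first by split.
    rewrite !lt_min => /and3P[e1 e2 e3]; split; first by rewrite ltW //= (lt_le_trans e1).
    move=> y /solutionP[hy Ly By]; apply: (sobnormv_eq0 ab hy).
    apply/eqP; rewrite eq_le sobnormv_ge0 andbT.
    apply: le_trans (stab e y _ hy) _; first by rewrite e0.
    have Ly' : aeI a b (fun t => 0 = Lop a b (A e) y t) by apply: aeI_sub Ly.
    by rewrite By (nrm0 np) (sobnormv_ae ab Ly' (inWv_cst ab k 0)) (sobnormv_cst0 _ ab) addr0 mulr0.
  move=> f c hf; split.
    apply: (boundary_problem_solvable ab m0 (hA e eI) (hB e eI)) => //.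
  move=> y1 y2 /solutionP[h1 L1 B1] /solutionP[h2 L2 B2].
  have : aeI a b (fun t => y1 t - y2 t = 0).
    apply: (trivE (fun t => y1 t - y2 t)); apply/solutionP; split.
    + exact: inWvB.
    + by apply: aeI_sub3 (LopB ab (A e) h1 h2) L1 L2 => t _ -> -> ->; rewrite subrr.
    + by rewrite (blinB (hB e eI) h1 h2) B1 B2 subrr.
  by apply: aeI_sub => t _ /eqP; rewrite subr_eq0 => /eqP.
- move=> e /andP[e0]; rewrite !lt_min => /and3P[e1 e2 e3] f0 fe c0 ce y0 ye hf0 hfe.
  move=> /solutionP[h0 L_0 B_0] /solutionP[he Le Be].
  have ee : e < eps0 by exact: lt_le_trans e1 dee.
  have eI : 0 <= e < eps0 by rewrite ltW.
  (* L(e) w and B(e) w are the residuals of y0 in the e-problem, so their norms add up to [dt].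
     Stability gives the upper estimate, boundedness of L(e) and B(e) the lower one. *)
  pose w t := y0 t - ye t.
  have hw : inWv a b k.+1 w by exact: inWvB.
  have Lw : aeI a b (fun t => Lop a b (A e) w t = Lop a b (A e) y0 t - fe t).
    by apply: aeI_sub2 (LopB ab (A e) h0 he) Le => t _ -> ->.
  have Bw : B e w = B e y0 - ce by rewrite (blinB (hB e eI) h0 he) Be.
  have nLw := sobnormv_ae ab Lw (inWv_Lop ab (hA e eI) hw).
  have ed : 0 < e < de by rewrite e0.
  have eB : 0 < e < dB by rewrite e0.
  have eA : 0 < e < dA by rewrite e0.
  have sA := ltW (hdA e eA ee).
  rewrite /= nLw -Bw; apply/andP; split; last exact: (stab e w ed hw).
  rewrite mulrC ler_pdivrMr; last exact: LM0.
  rewrite mulrC mulrDl; apply: lerD; last exact: (hM e w eB hw).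
  apply: le_trans (Lop_perturb ab (hA 0 z0) (hA e eI) hw) _.
  rewrite /L0 [leRHS]mulrDl; apply: lerD; first exact: (sobnormv_Lop ab (hA 0 z0) hw).
  apply: ler_wpM2r; first exact: sobnormv_ge0.
  rewrite -[leRHS]mulr1; apply: ler_wpM2l; last exact: sA.
  exact: exprn_ge0.
Qed.
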